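(* Assume the sub-Gaussian sampling model with $\mu_4\le 3$. There exist constants $c_0,C_2>0$ such that if $m>c_0 r\log^{10}n$, then with probability at least $1-1/n^2$ the following holds simultaneously for all positive semidefinite Toeplitz matrices $\Sigma\in\mathbb{R}^{n\times n}$ of rank at most $r$, all $\epsilon_2\ge0$ and all $\eta\in\mathbb{R}^m$ with $\|\eta\|_2\le\epsilon_2$: letting $y=\mathcal A(\Sigma)+\eta$, any minimizer $\hat\Sigma$ of $$\min_M\ \operatorname{Tr}(M)\quad\text{subject to}\quad M\succeq0,\ \ \|y-\mathcal A(M)\|_2\le\epsilon_2,\ \ M\text{ is Toeplitz}$$ satisfies $\|\hat\Sigma-\Sigma\|_{\mathrm F}\le C_2\,\epsilon_2/\sqrt m$.
   Context: Sub-Gaussian sampling model: the sensing vectors $a_1,\dots,a_m\in\mathbb{R}^n$ are i.i.d. copies of a random vector $z=(z_1,\dots,z_n)^\top$ whose entries are i.i.d. sub-Gaussian random variables with $\mathbb{E}[z_j]=0$, $\mathbb{E}[z_j^2]=1$ and $\mu_4:=\mathbb{E}[z_j^4]>1$. $\mathcal A(M)=(a_i^\top M a_i)_{i=1}^m$. A matrix is Toeplitz if its entries are constant along each diagonal. *)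

(* Defs.v *)
From HB Require Import structures.
From mathcomp Require Import all_boot all_order all_algebra.
From mathcomp Require Import all_classical all_reals all_analysis.
Set Implicit Arguments. Unset Strict Implicit. Unset Printing Implicit Defensive.
Import Order.TTheory GRing.Theory Num.Theory.
Local Open Scope classical_set_scope.
Local Open Scope ring_scope.

Definition psd (R : realType) (n : nat) (M : 'M[R]_n) : Prop :=
  M^T = M /\ forall v : 'cV[R]_n, 0 <= (v^T *m M *m v) ord0 ord0.

Definition toeplitz (R : realType) (n : nat) (M : 'M[R]_n) : Prop :=
  forall i j k l : 'I_n, (i%:Z - j%:Z = k%:Z - l%:Z)%R -> M i j = M k l.

Definition norm2 (R : realType) (m : nat) (v : 'cV[R]_m) : R :=
  Num.sqrt (\sum_(i < m) v i ord0 ^+ 2).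
Definition frob (R : realType) (n : nat) (M : 'M[R]_n) : R :=
  Num.sqrt (\sum_(i < n) \sum_(j < n) M i j ^+ 2).

Definition meas (R : realType) (m n : nat) (a : 'I_m -> 'I_n -> R)
  (M : 'M[R]_n) : 'cV[R]_m :=
  \col_(i < m) \sum_(j < n) \sum_(k < n) a i j * M j k * a i k.

Definition feasible (R : realType) (m n : nat) (a : 'I_m -> 'I_n -> R)
  (y : 'cV[R]_m) (eps : R) (M : 'M[R]_n) : Prop :=
  psd M /\ norm2 (y - meas a M) <= eps /\ toeplitz M.

Definition is_minimizer (R : realType) (m n : nat) (a : 'I_m -> 'I_n -> R)
  (y : 'cV[R]_m) (eps : R) (Mhat : 'M[R]_n) : Prop :=
  feasible a y eps Mhat /\
  forall M, feasible a y eps M -> \tr Mhat <= \tr M.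

Definition mutually_independent d (T : measurableType d) (R : realType)
  (P : probability T R) (I : finType) (X : I -> T -> R) : Prop :=
  forall B : I -> set R, (forall k, measurable (B k)) ->
    P (\bigcap_(k in [set: I]) (X k @^-1` B k)) = (\prod_(k : I) P (X k @^-1` B k))%E.

Definition subgaussian (R : realType) (nu : probability R R) : Prop :=
  exists K : R, 0 < K /\ forall t : R, 0 <= t ->
    (nu [set x : R | (t <= `|x|)%R] <= (2 * expR (- (t ^+ 2) / K ^+ 2))%:E)%E.

(* Main.v *)
Require Import Defs.
From HB Require Import structures.
From mathcomp Require Import all_boot all_order all_algebra.
From mathcomp Require Import all_classical all_reals all_analysis.
From mathcomp Require Import measurable_realfun.
From mathcomp Require Import zify ring lra.

(* Let [H] be the error of the estimator.  It is a symmetric Toeplitz matrix, and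
   since [Sigmahat] has minimal trace, the quadratic forms of [H] on the vectors
   of any tight frame sum in absolute value to at most [3 sqrt r |H|].  Applied to
   the Fourier frame of length [2n], this writes [H] as [b] times a convex
   combination of the [4n] signed atoms [+- W_l], with [b <= 3 sqrt r |H|].

   By Maurey's argument [H] is close to [b / d] times a sum of [d] atoms, where
   [d ~ r log^6 n], both in Frobenius norm and for the empirical quadratic form
   restricted to those sensing vectors [a_i] on which all the [a_i^T W_l a_i] are
   at most [K ~ log^3 n]; an exponential supermartingale shows that this happens
   with probability close to one.  For each of the [(4n)^d] sums of atoms [U], the
   moment bounds [E (a^T U a)^2 >= V >= |U|^2] and [E (a^T U a)^4 <= C V^2] and a
   Chernoff bound for nonnegative variables show that the truncated empirical
   quadratic form is at least [|U|^2 / 8] except with probability [exp (- c m)],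
   and a union bound concludes. *)

Set Implicit Arguments. Unset Strict Implicit. Unset Printing Implicit Defensive.
Import Order.TTheory GRing.Theory Num.Theory.
Import numFieldNormedType.Exports.
Local Open Scope classical_set_scope.
Local Open Scope ring_scope.

(** Only a lower bound for the empirical quadratic form over the admissible errors is needed, since
    feasibility of both [Sigma] and [Sigmahat] bounds the sum of its squares above by [4 eps2^2].
    Truncation is harmless in this direction: it merely drops nonnegative terms from the sum bounded
    below. It is forced by Maurey's argument, which needs bounded summands while the forms
    [a_i^T W_l a_i] are unbounded. The size [K ~ log^3 n] arises because the squares of the partial
    linear forms in the off-diagonal part of [a^T W_l a] sum to order [log^3 n]. The Maurey error in
    [|H|^2] is of order [b^2 K^2 / d], and [b <= 3 sqrt r |H|] makes it a fraction of [|H|^2] once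
    [d ~ r K^2]. The union over sums of atoms then costs [d log n ~ r log^7 n] in the exponent,
    within the assumed [r log^10 n]. The second moment bound rests on the diagonal of a Toeplitz
    matrix being constant, say [h]: the form has mean [n h], and [n^2 h^2] dominates the diagonal
    part [n h^2] of the squared Frobenius norm. *)

Section LinearAlgebra.
Context {R : realType}.

(** * Frobenius norm, tight frames, the trace cone and Maurey's argument *)

Lemma cauchy_schwarz_sum (I : finType) (a b : I -> R) :
  (\sum_i a i * b i) ^+ 2 <= (\sum_i a i ^+ 2) * (\sum_i b i ^+ 2).
Proof.
set A := \sum_i a i ^+ 2; set B := \sum_i b i ^+ 2; set c := \sum_i a i * b i.
have A0 : 0 <= A by apply: sumr_ge0 => i _; exact: sqr_ge0.
have key : \sum_i (A * b i - c * a i) ^+ 2 = A * (A * B - c ^+ 2).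
  transitivity (\sum_i (A ^+ 2 * b i ^+ 2 - 2 * A * c * (a i * b i) + c ^+ 2 * a i ^+ 2)).
    by apply: eq_bigr => i _; ring.
  rewrite big_split /= sumrB -!mulr_sumr -/A -/B -/c; ring.
have : 0 <= \sum_i (A * b i - c * a i) ^+ 2 by apply: sumr_ge0 => i _; exact: sqr_ge0.
rewrite key; have [A0'|An0] := eqVneq A 0; last first.
  by rewrite pmulr_rge0 ?subr_ge0// lt_neqAle eq_sym An0.
move=> _; rewrite A0' mul0r.
have a0 i : a i = 0.
  have /psumr_eq0P : A = 0 by [].
  move=> /(_ (fun i _ => sqr_ge0 (a i)) i isT) /eqP; rewrite sqrf_eq0 => /eqP //.
by rewrite /c big1 ?expr0n// => i _; rewrite a0 mul0r.
Qed.

Lemma cauchy_schwarz_norm (I : finType) (a b : I -> R) :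
  \sum_i `|a i * b i| <= Num.sqrt (\sum_i a i ^+ 2) * Num.sqrt (\sum_i b i ^+ 2).
Proof.
rewrite -sqrtrM; last by apply: sumr_ge0 => i _; exact: sqr_ge0.
apply: le_trans (ler_norm _) _; rewrite -sqrtr_sqr; apply: ler_wsqrtr.
under eq_bigr do rewrite normrM.
apply: le_trans (cauchy_schwarz_sum _ _) _.
by under eq_bigr do rewrite real_normK ?num_real//;
  under [X in _ * X]eq_bigr do rewrite real_normK ?num_real//.
Qed.

Definition sqn (m n : nat) (M : 'M[R]_(m, n)) : R := \sum_i \sum_j M i j ^+ 2.

Lemma sqn_ge0 m n (M : 'M[R]_(m, n)) : 0 <= sqn M.
Proof. by apply: sumr_ge0 => i _; apply: sumr_ge0 => j _; exact: sqr_ge0. Qed.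

Lemma sqn_tr m n (M : 'M[R]_(m, n)) : sqn M = \tr (M *m M^T).
Proof.
by apply: eq_bigr => i _; rewrite mxE; apply: eq_bigr => j _; rewrite mxE expr2.
Qed.

Lemma sqn_eq0 m n (M : 'M[R]_(m, n)) : sqn M = 0 -> M = 0.
Proof.
move=> /psumr_eq0P M0; apply/matrixP => i j; rewrite mxE.
have /psumr_eq0P : \sum_j M i j ^+ 2 = 0.
  by apply: M0 => // k _; apply: sumr_ge0 => l _; exact: sqr_ge0.
by move=> /(_ (fun l _ => sqr_ge0 (M i l)) j isT) /eqP; rewrite sqrf_eq0 => /eqP.
Qed.

Lemma frobE n (M : 'M[R]_n) : frob M = Num.sqrt (sqn M). Proof. by []. Qed.

Lemma frob_sqr n (M : 'M[R]_n) : frob M ^+ 2 = sqn M.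
Proof. by rewrite frobE sqr_sqrtr ?sqn_ge0. Qed.

Lemma sqn_tight_frame n N (F : 'M[R]_(n, N)) m (A : 'M[R]_(m, n)) :
  F *m F^T = 1%:M -> sqn (A *m F) = sqn A.
Proof.
by move=> FF; rewrite !sqn_tr trmx_mul !mulmxA -(mulmxA A) FF mulmx1.
Qed.


Lemma sum_norm_diag_mul m n (B C : 'M[R]_(m, n)) :
  \sum_t `|(B^T *m C) t t| <= Num.sqrt (sqn B) * Num.sqrt (sqn C).
Proof.
apply: le_trans (_ : \sum_(p : 'I_n * 'I_m) `|B p.2 p.1 * C p.2 p.1| <= _).
  rewrite -(pair_bigA _ (fun t j => `|B j t * C j t|)) /=.
  apply: ler_sum => t _; rewrite mxE; apply: le_trans (ler_norm_sum _ _ _) _.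
  by apply: ler_sum => j _; rewrite mxE.
apply: le_trans (cauchy_schwarz_norm _ _) _.
rewrite -(pair_bigA _ (fun t j => B j t ^+ 2)) -(pair_bigA _ (fun t j => C j t ^+ 2)) /=.
by rewrite /sqn exchange_big /= [X in _ * Num.sqrt X]exchange_big.
Qed.

(** Each diagonal entry pairs the images under [A] and [B] of one frame vector. Cauchy-Schwarz sums
    over the frame, and tightness turns the norms of [A F] and [B F] back into those of [A] and
    [B]. *)
Lemma sum_norm_quad_le n N (F : 'M[R]_(n, N)) (A B : 'M[R]_n) :
  F *m F^T = 1%:M ->
  \sum_t `|(F^T *m (A^T *m B) *m F) t t| <= Num.sqrt (sqn A) * Num.sqrt (sqn B).
Proof.
move=> FF; rewrite -(sqn_tight_frame A FF) -(sqn_tight_frame B FF).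
by rewrite !mulmxA -trmx_mul -mulmxA; exact: sum_norm_diag_mul.
Qed.

Lemma exists_range_projector n (S : 'M[R]_n) : S^T = S ->
  exists Pi : 'M[R]_n, [/\ Pi^T = Pi, Pi *m Pi = Pi, S *m Pi = S
    & \tr Pi = (\rank S)%:R].
Proof.
move=> Ssym.
have [k [C [D [SD Cfree <-]]]] : exists k (C : 'M[R]_(k, n)) (D : 'M[R]_(n, k)),
    [/\ S = D *m C, row_free C & k = \rank S].
  by exists (\rank S), (row_base S), (col_base S); rewrite mulmx_base row_base_free.
have [G GE] : exists G, G = C *m C^T by eexists.
have Gu : G \in unitmx.
  rewrite -row_free_unit -kermx_eq0; apply/eqP/row_matrixP => i; rewrite row0.
  set u := row i _.
  have uG : u *m G = 0 by apply/sub_kermxP; exact: row_sub.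
  have /sqn_eq0 uC : sqn (u *m C) = 0.
    by rewrite sqn_tr trmx_mul mulmxA -(mulmxA u) -GE uG mul0mx mxtrace0.
  by apply: (row_free_inj Cfree); rewrite uC mul0mx.
have Gsym : G^T = G by rewrite GE trmx_mul trmxK.
exists (C^T *m invmx G *m C); split.
- by rewrite !trmx_mul trmxK trmx_inv Gsym mulmxA.
- rewrite !mulmxA -(mulmxA _ C) -GE -(mulmxA _ (invmx G) G) mulVmx// mulmx1 //.
- by rewrite {1}SD !mulmxA -(mulmxA D) -GE -(mulmxA D) mulmxV// mulmx1 -SD.
- by rewrite mxtrace_mulC mulmxA -GE mulmxV// mxtrace1.
Qed.

Lemma psd_conj n p (M : 'M[R]_n) (A : 'M[R]_(n, p)) t :
  psd M -> 0 <= (A^T *m M *m A) t t.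
Proof.
move=> [_ /(_ (col t A))]; congr (0 <= _).
by rewrite tr_col -row_mul !mxE; apply: eq_bigr => j _; rewrite !mxE.
Qed.

(* With [Pi] the projector on the range of [S], the compression of [H] to the
   complement is that of [Shat], hence positive with trace at most [- tr (Pi H)];
   the rest of [H] is [Pi] times a matrix of norm at most [2 |H|]. *)
Lemma sum_norm_diag_le n N r (F : 'M[R]_(n, N)) (S Shat : 'M[R]_n) :
  F *m F^T = 1%:M -> psd S -> psd Shat -> (\rank S <= r)%N -> \tr Shat <= \tr S ->
  \sum_t `|(F^T *m (Shat - S) *m F) t t| <= 3 * Num.sqrt r%:R * frob (Shat - S).
Proof.
move=> FF pS pShat rS trS.
have [H HE] : exists H : 'M[R]_n, H = Shat - S by eexists.
rewrite -HE; have [Ssym _] := pS; have [Shsym _] := pShat.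
have Hsym : H^T = H by rewrite HE linearB /= Ssym Shsym.
have [Pi [Pisym Pi2 SPi trPi]] := exists_range_projector Ssym.
have PiS : Pi *m S = S by apply: trmx_inj; rewrite trmx_mul Ssym Pisym.
have [Q QE] : exists Q : 'M[R]_n, Q = 1%:M - Pi by eexists.
have Qsym : Q^T = Q by rewrite QE linearB /= Pisym trmx1.
have sPi : sqn Pi = (\rank S)%:R by rewrite sqn_tr Pisym Pi2.
have sq_rank : Num.sqrt (sqn Pi) <= Num.sqrt r%:R.
  by rewrite sPi ler_wsqrtr// ler_nat.
have QHQ : Q^T *m Shat *m Q = Q *m H *m Q.
  have QS : Q *m S = 0 by rewrite QE mulmxBl mul1mx PiS subrr.
  by rewrite Qsym HE [in RHS]mulmxBr QS subr0.
(* [H - Q H Q = Pi H + H Pi - Pi H Pi], and a quadratic form does not distinguish [H Pi] from its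
   transpose [Pi H]; so this difference acts as [Pi (2 H - H Pi)]. *)
have [K KE] : exists K : 'M[R]_n, K = 2 *: H - H *m Pi by eexists.
pose q t (A : 'M[R]_n) := (F^T *m A *m F) t t.
have qD t A B : q t (A + B) = q t A + q t B by rewrite /q mulmxDr mulmxDl mxE.
have qN t A : q t (- A) = - q t A by rewrite /q mulmxN mulNmx mxE.
have qT t A : q t A^T = q t A.
  rewrite /q -[in LHS](trmxK F) -mulmxA -!trmx_mul [in LHS]mxE.
  by rewrite trmxK.
have decomp t : q t H = q t (Pi^T *m K) + q t (Q *m H *m Q).
  have -> : Pi^T *m K = Pi *m H + (Pi *m H - Pi *m H *m Pi).
    by rewrite Pisym KE mulmxBr -scalemxAr scaler_nat mulr2n addrA mulmxA.
  have -> : Q *m H *m Q = H - H *m Pi - Pi *m H + Pi *m H *m Pi.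
    rewrite QE mulmxBr mulmx1 mulmxBl mul1mx mulmxBl.
    move: (Pi *m H *m Pi) (Pi *m H) (H *m Pi) => a b c.
    by apply/matrixP => i j; rewrite !mxE; ring.
  rewrite !qD !qN -(qT _ (H *m Pi)) trmx_mul Pisym Hsym; ring.
have FFtr (A : 'M[R]_n) : \tr (F^T *m A *m F) = \tr A.
  by rewrite mxtrace_mulC mulmxA FF mul1mx.
have sqnK : sqn K <= 4 * sqn H.
  have -> : sqn K = 4 * sqn H - 3 * sqn (H *m Pi).
    have e : K *m K^T = 4 *: (H *m H^T) - 3 *: (H *m Pi *m (H *m Pi)^T).
      rewrite KE linearB /= linearZ /= trmx_mul Pisym Hsym.
      rewrite mulmxBr !mulmxBl -!scalemxAr -!scalemxAl !mulmxA -(mulmxA H Pi Pi) Pi2.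
      move: (H *m H) (H *m Pi *m H) => a b.
      by apply/matrixP => i j; rewrite !mxE; ring.
    by rewrite !sqn_tr e linearB /= !linearZ.
  by rewrite gerBl mulr_ge0 ?sqn_ge0.
have sqK : Num.sqrt (sqn K) <= 2 * frob H.
  rewrite frobE (_ : 2 = Num.sqrt (4 : R)); last first.
    by rewrite (_ : 4 = 2 ^+ 2) ?sqrtr_sqr ?normr_nat// -natrX.
  by rewrite -sqrtrM// ler_wsqrtr.
have T1 : \sum_t `|(F^T *m (Pi^T *m K) *m F) t t| <= Num.sqrt r%:R * (2 * frob H).
  apply: le_trans (sum_norm_quad_le _ _ FF) _.
  by apply: ler_pM; rewrite ?sqrtr_ge0.
have T2 : \sum_t `|(F^T *m (Q *m H *m Q) *m F) t t| <= Num.sqrt r%:R * frob H.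
  have -> : \sum_t `|(F^T *m (Q *m H *m Q) *m F) t t| = \tr (F^T *m (Q *m H *m Q) *m F).
    apply: eq_bigr => t _; rewrite ger0_norm// -QHQ !mulmxA -trmx_mul -mulmxA.
    exact: psd_conj.
  rewrite FFtr.
  have -> : \tr (Q *m H *m Q) = \tr H - \tr (Pi *m H).
    have QQ : Q *m Q = Q.
      by rewrite QE mulmxBr !mulmxBl !mulmx1 !mul1mx Pi2 subrr subr0.
    by rewrite mxtrace_mulC mulmxA QQ QE mulmxBl mul1mx linearB.
  have trH : \tr H <= 0 by rewrite HE linearB /= subr_le0.
  have : `|\tr (Pi *m H)| <= Num.sqrt r%:R * frob H.
    apply: le_trans (_ : \sum_t `|(Pi^T *m H) t t| <= _).
      by rewrite Pisym; exact: ler_norm_sum.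
    apply: le_trans (sum_norm_diag_mul _ _) _.
    by rewrite ler_wpM2r ?sqrtr_ge0.
  rewrite ler_norml => /andP[lo _]; move: lo trH; lra.
apply: le_trans (_ : _ <= Num.sqrt r%:R * (2 * frob H) + Num.sqrt r%:R * frob H) _.
  apply: le_trans (lerD T1 T2); rewrite -big_split /=.
  by apply: ler_sum => t _; rewrite [X in `|X|]decomp ler_normD.
by rewrite le_eqVlt; apply/orP; left; apply/eqP; ring.
Qed.

(* Greedy form of Maurey's argument: averaged over [l] with weights [p], the
   next increment raises the squared norm by at most [B]. *)
Lemma maurey (L T : finType) (p : L -> R) (y : L -> T -> R) (B : R) (d : nat) :
  (forall l, 0 <= p l) -> \sum_l p l = 1 -> (forall l, \sum_t y l t ^+ 2 <= B) ->
  exists s : {ffun 'I_d -> L},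
    \sum_t (\sum_(k < d) y (s k) t - d%:R * \sum_l p l * y l t) ^+ 2 <= d%:R * B.
Proof.
move=> p0 p1 yB; pose z t := \sum_l p l * y l t.
elim: d => [|d [s IHs]].
  have [l _|L0] := pickP (fun _ : L => true); last first.
    by move: p1; rewrite big_pred0 // => /eqP; rewrite eq_sym oner_eq0.
  exists [ffun _ => l].
  by rewrite mul0r big1// => t _; rewrite big_ord0 mul0r subrr expr0n.
pose S t := \sum_(k < d) y (s k) t - d%:R * z t.
(* The cross term with [y - z] averages to zero, so the mean is [|S|^2] plus a variance of at most
   [B]; some [l] does no worse than the mean. *)
have avg : \sum_l p l * (\sum_t (S t + y l t - z t) ^+ 2) <= d.+1%:R * B.
  have -> : \sum_l p l * (\sum_t (S t + y l t - z t) ^+ 2) =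
      \sum_t S t ^+ 2 + \sum_l p l * (\sum_t y l t ^+ 2) - \sum_t z t ^+ 2.
    under eq_bigr do rewrite mulr_sumr.
    under [X in _ = _ + X - _]eq_bigr do rewrite mulr_sumr.
    rewrite exchange_big /= [X in _ = _ + X - _]exchange_big /= -big_split -sumrB /=.
    apply: eq_bigr => t _.
    transitivity (\sum_l (p l * (S t - z t) ^+ 2 + 2 * (S t - z t) * (p l * y l t) + p l * y l t ^+ 2)).
      by apply: eq_bigr => l _; ring.
    by rewrite !big_split /= -mulr_suml -mulr_sumr p1 -/(z t); ring.
  have h1 : \sum_l p l * (\sum_t y l t ^+ 2) <= B.
    rewrite -[leRHS]mul1r -p1 mulr_suml; apply: ler_sum => l _.
    exact: ler_wpM2l.
  have h2 : 0 <= \sum_t z t ^+ 2 by apply: sumr_ge0 => t _; exact: sqr_ge0.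
  have h3 : \sum_t S t ^+ 2 <= d%:R * B by [].
  rewrite -natr1; move: h1 h2 h3; lra.
have [l lB] : exists l, \sum_t (S t + y l t - z t) ^+ 2 <= d.+1%:R * B.
  move: (d.+1%:R * B) avg => M avg; apply: contrapT => /forallNP hl.
  have [l0 pl0] : exists l, 0 < p l.
    apply: contrapT => /forallNP h.
    have : \sum_l p l = 0.
      by apply: big1 => l _; apply/eqP; rewrite eq_le p0 andbT leNgt; apply/negP/h.
    by rewrite p1 => /eqP; rewrite oner_eq0.
  have : M < \sum_l p l * (\sum_t (S t + y l t - z t) ^+ 2).
    rewrite -[ltLHS]mul1r -p1 mulr_suml (bigD1 l0)//= [ltRHS](bigD1 l0)//=.
    apply: ltr_leD; first by rewrite ltr_pM2l// ltNge; apply/negP/hl.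
    by apply: ler_sum => l _; apply: ler_wpM2l => //; rewrite leNgt; apply/negP => /ltW/hl.
  by rewrite ltNge avg.
exists [ffun k => if unlift ord_max k is Some j then s j else l].
move: lB; congr (_ <= _); apply: eq_bigr => t _; congr (_ ^+ 2).
rewrite big_ord_recr /= ffunE unlift_none -natr1 mulrDl mul1r -/(z t) /S.
have -> : \sum_(i < d) y ([ffun k => if unlift ord_max k is Some j then s j else l]
    (widen_ord (leqnSn d) i)) t = \sum_(i < d) y (s i) t.
  apply: eq_bigr => i _; rewrite ffunE.
  have -> : widen_ord (leqnSn d) i = lift ord_max i by apply/val_inj; rewrite /= /bump leqNgt ltn_ord.
  by rewrite liftK.
ring.
Qed.
End LinearAlgebra.

(** * Discrete Fourier analysis of symmetric Toeplitz matrices *)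

Section ToeplitzAtoms.
Context {R : realType}.

Definition ndist (j k : nat) : nat := ((j - k) + (k - j))%N.

Lemma ndist_lt n (j k : 'I_n) : (ndist j k < n)%N.
Proof. by have := ltn_ord j; have := ltn_ord k; rewrite /ndist; lia. Qed.

Lemma ndistC j k : ndist j k = ndist k j.
Proof. by rewrite /ndist addnC. Qed.

Lemma cos_ndist (x : R) (D E : nat) : cos (x * D%:R - x * E%:R) = cos (x * (ndist D E)%:R).
Proof.
rewrite /ndist; have [DE|/ltnW DE] := leqP D E.
  by rewrite (eqP DE) add0n natrB// mulrBr -cosN opprB.
by rewrite (eqP DE) addn0 natrB// mulrBr.
Qed.

(** [2 sin (t/2) cos (l t) = sin ((l + 1/2) t) - sin ((l - 1/2) t)] telescopes. The factor stays on
    the left, so that nothing is divided by a sine that may vanish. *)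
Lemma dirichlet_cos (t : R) M :
  2 * sin (t / 2) * (\sum_(l < M) cos (l%:R * t)) = sin (M%:R * t - t / 2) + sin (t / 2).
Proof.
elim: M => [|M IH]; first by rewrite big_ord0 mulr0 mul0r sub0r sinN addNr.
rewrite big_ord_recr /= mulrDr IH sinB.
have -> : M.+1%:R * t - t / 2 = M%:R * t + t / 2 by rewrite -natr1; field.
rewrite sinD; ring.
Qed.

(** With [t = e pi / n] the total phase [2 n t] is a multiple of [2 pi], so the closed form
    collapses to zero; for [0 < e < 2 n] the half angle lies strictly between 0 and [pi], and the
    sine can be cancelled. *)
Lemma sum_cos (n e : nat) : (0 < n)%N -> (e < 2 * n)%N ->
  \sum_(l < 2 * n) cos (l%:R * (e%:R * (pi / n%:R))) = (2 * n * (e == 0))%:R :> R.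
Proof.
move=> n0 en; case: eqP => [->|/eqP e0].
  under eq_bigr do rewrite mul0r mulr0 cos0.
  by rewrite sumr_const card_ord muln1.
rewrite muln0; set t : R := e%:R * _.
have nR : 0 < n%:R :> R by rewrite ltr0n.
have eR : 0 < e%:R :> R by rewrite ltr0n lt0n.
have st : 0 < sin (t / 2).
  apply: sin_gt0_pi; apply/andP; split; first by rewrite !mulr_gt0 ?pi_gt0 ?invr_gt0.
  have -> : t / 2 = pi * (e%:R / (2 * n)%:R) by rewrite /t natrM; field; rewrite gt_eqF.
  rewrite -[ltRHS]mulr1 ltr_pM2l ?pi_gt0// ltr_pdivrMr ?mul1r ?ltr_nat//.
  by rewrite ltr0n muln_gt0.
have := dirichlet_cos t (2 * n).
have -> : (2 * n)%:R * t - t / 2 = - (t / 2) + (pi *+ 2) *+ e.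
  by rewrite /t natrM -[_ *+ e]mulr_natr -[pi *+ 2]mulr_natr; field; rewrite gt_eqF.
rewrite (periodicn (@sinD2pi R)) sinN addNr => /eqP.
by rewrite mulf_eq0 gt_eqF ?mulr_gt0//= => /eqP.
Qed.

(** Product-to-sum produces the frequencies [|D - E|] and [D + E]. The second can reach [2 n - 2],
    which is why the transform has length [2 n] and not [n]. Both vanish when [D = E = 0], which
    doubles the constant there. *)
Lemma sum_cos_cos (n D E : nat) : (D < n)%N -> (E < n)%N ->
  \sum_(l < 2 * n) cos (l%:R * (D%:R * (pi / n%:R))) * cos (l%:R * (E%:R * (pi / n%:R)))
  = (n * ((D == E) + (D + E == 0)))%:R :> R.
Proof.
move=> Dn En; have n0 : (0 < n)%N by lia.
set w : R := pi / n%:R.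
transitivity ((\sum_(l < 2 * n) cos (l%:R * ((ndist D E)%:R * w)) +
               \sum_(l < 2 * n) cos (l%:R * ((D + E)%:R * w))) / 2).
  rewrite -big_split mulr_suml /=; apply: eq_bigr => l _.
  have -> : l%:R * ((ndist D E)%:R * w) = (l%:R * w) * (ndist D E)%:R by ring.
  rewrite -cos_ndist natrD cosB.
  have -> : l%:R * ((D%:R + E%:R) * w) = l%:R * w * D%:R + l%:R * w * E%:R by ring.
  rewrite cosD.
  have -> : l%:R * (D%:R * w) = l%:R * w * D%:R by ring.
  have -> : l%:R * (E%:R * w) = l%:R * w * E%:R by ring.
  by field.
rewrite !sum_cos//; try by rewrite /ndist; lia.
have -> : (ndist D E == 0) = (D == E) by rewrite /ndist; lia.
by rewrite -natrD -mulnDr -mulnA natrM; field.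
Qed.

(** Real and imaginary parts of the [2 n] Fourier vectors. Both are needed: adding the quadratic
    forms at the cosine and the sine vector of index [l] leaves only [cos] of the differences
    [j - k], which is [fcoef]. *)
Definition fourier_frame n : 'M[R]_(n, 2 * n + 2 * n) :=
  \matrix_(j, t) (match fintype.split t with
    | inl l => cos (l%:R * (j%:R * (pi / n%:R)))
    | inr l => sin (l%:R * (j%:R * (pi / n%:R))) end / Num.sqrt (2 * n)%:R).

Lemma fourier_frame_tight n : fourier_frame n *m (fourier_frame n)^T = 1%:M.
Proof.
apply/matrixP => j k; rewrite !mxE big_split_ord /= -big_split /=.
have n0 : (0 < n)%N by apply: leq_ltn_trans (ltn_ord j).
have s0 : 0 < (2 * n)%:R :> R by rewrite ltr0n muln_gt0.
have := sum_cos n0 (_ : (ndist j k < 2 * n)%N).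
move=> /(_ (leq_trans (ndist_lt j k) _)) H.
transitivity ((\sum_(l < 2 * n) cos (l%:R * ((ndist j k)%:R * (pi / n%:R)))) / (2 * n)%:R : R).
  rewrite mulr_suml; apply: eq_bigr => l _; rewrite !mxE.
  rewrite -[lshift _ l]/(unsplit (inl l)) -[rshift _ l]/(unsplit (inr l)) !unsplitK.
  have -> : l%:R * ((ndist j k)%:R * (pi / n%:R)) = (l%:R * (pi / n%:R)) * (ndist j k)%:R :> R by ring.
  rewrite -cos_ndist cosB.
  have -> : l%:R * (pi / n%:R) * j%:R = l%:R * (j%:R * (pi / n%:R)) :> R by ring.
  have -> : l%:R * (pi / n%:R) * k%:R = l%:R * (k%:R * (pi / n%:R)) :> R by ring.
  have -> : ((2 * n)%:R)^-1 = (Num.sqrt (2 * n)%:R)^-1 * (Num.sqrt (2 * n)%:R)^-1 :> R.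
    by rewrite -invfM -expr2 sqr_sqrtr// ltW.
  ring.
rewrite H; last by rewrite leq_pmull.
have -> : (ndist j k == 0) = (j == k).
  by rewrite -val_eqE /= /ndist; lia.
by rewrite natrM mulrAC divff ?mul1r// gt_eqF.
Qed.

Lemma quad_entry n N (F : 'M[R]_(n, N)) (H : 'M[R]_n) t :
  (F^T *m H *m F) t t = \sum_j \sum_k H j k * (F j t * F k t).
Proof.
rewrite mxE exchange_big /=; apply: eq_bigr => k _; rewrite mxE mulr_suml.
by apply: eq_bigr => j _; rewrite mxE; ring.
Qed.

(* Inverting the discrete Fourier transform of length [2n] along the diagonals
   shows that a symmetric Toeplitz matrix is the combination of these matrices
   whose coefficients [fcoef] are its quadratic forms on the Fourier vectors. *)
Definition atom n (l : nat) : 'M[R]_n :=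
  \matrix_(j, k) (cos (l%:R * ((ndist j k)%:R * (pi / n%:R))) / (n - ndist j k)%:R).

Lemma count_shift n D : (D <= n)%N ->
  \sum_(j < n) \sum_(k < n) ((j == (k + D)%N :> nat)%:R : R) = (n - D)%:R.
Proof.
move=> Dn; rewrite exchange_big /=.
transitivity (\sum_(k < n) ((k < n - D)%N)%:R : R).
  apply: eq_bigr => k _; have [kD|kD] := ltnP k (n - D).
    have kDn : (k + D < n)%N by lia.
    rewrite (bigD1 (Ordinal kDn))//= eqxx big1 ?addr0// => j jk.
    by apply/eqP; rewrite pnatr_eq0 eqb0; apply: contra jk => /eqP jk; apply/eqP/val_inj.
  by rewrite big1// => j _; apply/eqP; rewrite pnatr_eq0 eqb0; have := ltn_ord j; lia.
transitivity (\sum_(k < n | (k < n - D)%N) (1 : R)).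
  by rewrite [RHS]big_mkcond; apply: eq_bigr => k _; case: ifP.
by rewrite -(big_ord_widen n (fun _ => 1)) ?leq_subr// sumr_const card_ord.
Qed.

Lemma count_shift_sym n D : (D <= n)%N ->
  \sum_(j < n) \sum_(k < n) (((j == (k + D)%N :> nat) + (k == (j + D)%N :> nat))%N%:R : R) = 2 * (n - D)%:R.
Proof.
move=> Dn; under eq_bigr do under eq_bigr do rewrite natrD.
under eq_bigr do rewrite big_split /=.
by rewrite big_split /= count_shift// exchange_big /= count_shift//; ring.
Qed.

Lemma toeplitz_ndist n (H : 'M[R]_n) (a b j k : 'I_n) : toeplitz H -> H^T = H ->
  ndist j k = ndist a b -> H j k = H a b.
Proof.
move=> tH sH; have sHE (x y : 'I_n) : H x y = H y x by rewrite -[in LHS]sH mxE.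
rewrite /ndist => e.
have [jk|kj] := leqP j k; have [ab|ba] := leqP a b.
- by apply: tH; lia.
- by rewrite sHE; apply: tH; lia.
- by rewrite sHE; apply: tH; lia.
- by apply: tH; lia.
Qed.

Definition fcoef n (H : 'M[R]_n) (l : nat) : R :=
  (\sum_j \sum_k H j k * cos (l%:R * ((ndist j k)%:R * (pi / n%:R)))) / (2 * n)%:R.

Lemma sum_atoms n (H : 'M[R]_n) : toeplitz H -> H^T = H ->
  H = \sum_(l < 2 * n) fcoef H l *: atom n l.
Proof.
move=> tH sH; apply/matrixP => a b; rewrite summxE.
have n0 : (0 < n)%N by apply: leq_ltn_trans (ltn_ord a).
have n0R : 0 < n%:R :> R by rewrite ltr0n.
set D := ndist a b; have Dn : (D < n)%N := ndist_lt a b.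
have nD : 0 < (n - D)%:R :> R by rewrite ltr0n subn_gt0.
transitivity ((\sum_(l < 2 * n) fcoef H l * cos (l%:R * (D%:R * (pi / n%:R)))) / (n - D)%:R); last first.
  by rewrite mulr_suml; apply: eq_bigr => l _; rewrite !mxE -/D [RHS]mulrA.
apply: (canRL (mulfK (lt0r_neq0 nD))).
transitivity (\sum_j \sum_k H j k * ((\sum_(l < 2 * n) cos (l%:R * ((ndist j k)%:R * (pi / n%:R)))
    * cos (l%:R * (D%:R * (pi / n%:R)))) / (2 * n)%:R)); last first.
  rewrite /fcoef; under [RHS]eq_bigr do rewrite !mulr_suml.
  rewrite [RHS]exchange_big /=; apply: eq_bigr => j _.
  under [RHS]eq_bigr do rewrite !mulr_suml.
  rewrite [RHS]exchange_big /=; apply: eq_bigr => k _.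
  by rewrite mulr_suml mulr_sumr; apply: eq_bigr => l _; ring.
(* For [D = 0] both shift indicators hold on the diagonal, matching the doubled orthogonality
   constant at frequency zero; the weight [H a b / 2] therefore serves every diagonal. *)
transitivity (\sum_(j < n) \sum_(k < n) H a b / 2 * ((j == (k + D)%N :> nat) + (k == (j + D)%N :> nat))%:R).
  under eq_bigr do rewrite -mulr_sumr.
  by rewrite -mulr_sumr count_shift_sym 1?ltnW//; field.
apply: eq_bigr => j _; apply: eq_bigr => k _; rewrite sum_cos_cos ?ndist_lt//.
have -> : ((ndist j k == D) + (ndist j k + D == 0) = (j == (k + D)%N :> nat) + (k == (j + D)%N :> nat))%N.
  by rewrite {1 2}/ndist; lia.
have [e|ne] := eqVneq (ndist j k) D.
  rewrite (toeplitz_ndist tH sH e) !natrM; field; exact: lt0r_neq0.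
have -> : ((j == (k + D)%N :> nat) + (k == (j + D)%N :> nat) = 0)%N by move: ne; rewrite /ndist; lia.
by rewrite muln0 !(mul0r, mulr0).
Qed.

(** The coefficient at [l] is the sum of the forms at the cosine and sine vectors of index [l], so
    its absolute value is controlled by the two corresponding terms of the trace cone inequality. *)
Lemma sum_fcoef_le n r (S Shat : 'M[R]_n) :
  psd S -> psd Shat -> (\rank S <= r)%N -> \tr Shat <= \tr S ->
  \sum_(l < 2 * n) `|fcoef (Shat - S) l| <= 3 * Num.sqrt r%:R * frob (Shat - S).
Proof.
move=> pS pSh rS trS; set H := Shat - S.
apply: le_trans (sum_norm_diag_le (fourier_frame_tight n) pS pSh rS trS).
rewrite [leRHS]big_split_ord /= -big_split /=; apply: ler_sum => l _.
apply: le_trans (ler_normD _ _); rewrite le_eqVlt; apply/orP; left; apply/eqP; congr `|_|.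
rewrite !quad_entry -big_split /fcoef mulr_suml /=; apply: eq_bigr => j _.
rewrite -big_split mulr_suml /=; apply: eq_bigr => k _; rewrite !mxE.
rewrite -[lshift _ l]/(unsplit (inl l)) -[rshift _ l]/(unsplit (inr l)) !unsplitK.
have -> : l%:R * ((ndist j k)%:R * (pi / n%:R)) = (l%:R * (pi / n%:R)) * (ndist j k)%:R :> R by ring.
rewrite -cos_ndist cosB.
have -> : l%:R * (pi / n%:R) * j%:R = l%:R * (j%:R * (pi / n%:R)) :> R by ring.
have -> : l%:R * (pi / n%:R) * k%:R = l%:R * (k%:R * (pi / n%:R)) :> R by ring.
have -> : ((2 * n)%:R)^-1 = (Num.sqrt (2 * n)%:R)^-1 * (Num.sqrt (2 * n)%:R)^-1 :> R.
  by rewrite -invfM -expr2 sqr_sqrtr.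
ring.
Qed.

Lemma harmonic_le n : (0 < n)%N -> \sum_(i < n) (i.+1%:R)^-1 <= 1 + ln n%:R :> R.
Proof.
elim: n => // -[_ _|n IH _]; first by rewrite big_ord1 ln1 addr0 invr1.
rewrite big_ord_recr /=; have n1 : 0 < n.+1%:R :> R by rewrite ltr0n.
have n2 : 0 < n.+2%:R :> R by rewrite ltr0n.
have : ln n.+1%:R + n.+2%:R^-1 <= ln n.+2%:R :> R.
  have -> : n.+1%:R = n.+2%:R * (1 + - n.+2%:R^-1) :> R.
    by rewrite mulrDr mulr1 mulrN divff ?gt_eqF// -[n.+2%:R]natr1 addrK.
  have h : 0 < 1 + - n.+2%:R^-1 :> R.
    by rewrite subr_gt0 invf_lt1// ltr1n.
  rewrite lnM ?posrE// -addrA gerDl.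
  have h2 : - 1 < - n.+2%:R^-1 :> R by rewrite ltrN2 invf_lt1// ltr1n.
  by rewrite -lerBrDr sub0r; exact: le_ln1Dx.
by have := IH isT; move: (\sum_(i < n.+1) _) (ln n.+1%:R) (ln n.+2%:R) (n.+2%:R^-1) => a b c e; lra.
Qed.

(** Squared norm of row [j] of an atom with the cosine replaced by one: a bound common to all
    [l]. *)
Definition rowsq n (j : nat) : R := \sum_(k < n) ((n - ndist j k)%:R ^+ 2)^-1.

Lemma rowsq_gt0 n (j : 'I_n) : 0 < rowsq n j.
Proof.
rewrite /rowsq (bigD1 j)//= ltr_pwDl//.
  by rewrite invr_gt0 exprn_gt0// ltr0n subn_gt0 ndist_lt.
by apply: sumr_ge0 => k _; rewrite invr_ge0 sqr_ge0.
Qed.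

(** Grouped by distance [D], about [2 (n - D)] entries of size [(n - D)^-2] leave twice a harmonic
    sum. This logarithm is the squared Frobenius norm of an atom. *)
Lemma sum_rowsq_le n : (0 < n)%N -> \sum_(j < n) rowsq n j <= 2 * (1 + ln n%:R).
Proof.
move=> n0; rewrite /rowsq.
pose f D : R := ((n - D)%:R ^+ 2)^-1.
have f0 D : 0 <= f D by rewrite invr_ge0 sqr_ge0.
apply: le_trans (_ : \sum_(j < n) \sum_(k < n) \sum_(D < n)
    f D * ((j == (k + D)%N :> nat) + (k == (j + D)%N :> nat))%:R <= _).
  apply: ler_sum => j _; apply: ler_sum => k _.
  rewrite (bigD1 (Ordinal (ndist_lt j k)))//=.
  apply: le_trans (_ : f (ndist j k) * 1 <= _); first by rewrite mulr1.
  rewrite -[leLHS]addr0; apply: lerD.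
    by apply: ler_wpM2l => //; rewrite ler1n /ndist; lia.
  by apply: sumr_ge0 => D _; rewrite mulr_ge0.
under eq_bigr do rewrite exchange_big /=.
rewrite exchange_big /=.
apply: le_trans (_ : \sum_(D < n) 2 * (n - D)%:R^-1 <= _).
  apply: ler_sum => D _.
  under eq_bigr do rewrite -mulr_sumr.
  rewrite -mulr_sumr count_shift_sym 1?ltnW ?ltn_ord// /f.
  have h : 0 < (n - D)%:R :> R by rewrite ltr0n subn_gt0.
  by rewrite le_eqVlt; apply/orP; left; apply/eqP; field; rewrite gt_eqF.
rewrite -mulr_sumr ler_pM2l//.
apply: le_trans (harmonic_le n0).
rewrite (reindex_inj rev_ord_inj) /=; apply: ler_sum => i _.
by rewrite subKn.
Qed.

Lemma atom_row_le n l (j : 'I_n) : \sum_k atom n l j k ^+ 2 <= rowsq n j.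
Proof.
apply: ler_sum => k _; rewrite mxE expr_div_n -[leRHS]mul1r ler_wpM2r ?invr_ge0 ?sqr_ge0//.
Qed.

Lemma sqn_atom_le n l : (0 < n)%N -> sqn (atom n l) <= 2 * (1 + ln n%:R).
Proof.
by move=> n0; apply: le_trans (sum_rowsq_le n0); apply: ler_sum => j _; exact: atom_row_le.
Qed.

Lemma atom_sym n l (j k : 'I_n) : atom n l j k = atom n l k j.
Proof. by rewrite !mxE ndistC. Qed.

Lemma atom_diag n l (j : 'I_n) : atom n l j j = n%:R^-1.
Proof. by rewrite mxE /ndist subnn addn0 subn0 mul0r mulr0 cos0 mul1r. Qed.

End ToeplitzAtoms.

Lemma measurable_sum_cond {R : realType} (d : measure_display) (T : measurableType d)
    (I : Type) (s : seq I) (P : pred I) (h : I -> T -> R) :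
  (forall i, P i -> measurable_fun setT (h i)) ->
  measurable_fun setT (fun x => \sum_(i <- s | P i) h i x).
Proof.
move=> mh; rewrite (_ : (fun x => _) = (fun x => \sum_(i <- s) (if P i then h i x else 0))).
  by apply: measurable_sum => i; case: (boolP (P i)) => // Pi; exact: mh.
by apply/funext => x; rewrite big_mkcond.
Qed.

(** * Integrals of nonnegative functions *)

Section NonnegIntegrals.
Context {R : realType} (d : measure_display) (T : measurableType d)
  (mu : {measure set T -> \bar R}).
Implicit Types f g : T -> R.

Lemma int_le f g : measurable_fun setT f -> measurable_fun setT g ->
  (forall x, 0 <= f x) -> (forall x, f x <= g x) ->
  (\int[mu]_x (f x)%:E <= \int[mu]_x (g x)%:E)%E.
Proof.
move=> mf mg f0 fg; apply: ge0_le_integral => //.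
- by move=> x _; rewrite lee_fin.
- exact/measurable_EFinP.
- exact/measurable_EFinP.
- by move=> x _; rewrite lee_fin.
Qed.

Lemma intD f g : measurable_fun setT f -> measurable_fun setT g ->
  (forall x, 0 <= f x) -> (forall x, 0 <= g x) ->
  (\int[mu]_x (f x + g x)%:E = \int[mu]_x (f x)%:E + \int[mu]_x (g x)%:E)%E.
Proof.
move=> mf mg f0 g0; rewrite -ge0_integralD//.
- by move=> x _; rewrite lee_fin.
- exact/measurable_EFinP.
- by move=> x _; rewrite lee_fin.
- exact/measurable_EFinP.
Qed.

Lemma intZ (c : R) f : measurable_fun setT f -> (forall x, 0 <= f x) -> 0 <= c ->
  (\int[mu]_x (c * f x)%:E = c%:E * \int[mu]_x (f x)%:E)%E.
Proof.
move=> mf f0 c0; rewrite -ge0_integralZl//.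
- exact/measurable_EFinP.
- by move=> x _; rewrite lee_fin.
Qed.

Lemma int_ge0 f : (forall x, 0 <= f x) -> (0 <= \int[mu]_x (f x)%:E)%E.
Proof. by move=> f0; apply: integral_ge0 => x _; rewrite lee_fin. Qed.

Lemma int_sum (I : Type) (s : seq I) (F : I -> T -> R) :
  (forall i, measurable_fun setT (F i)) -> (forall i x, 0 <= F i x) ->
  (\int[mu]_x (\sum_(i <- s) F i x)%:E = \sum_(i <- s) \int[mu]_x (F i x)%:E)%E.
Proof.
move=> mF F0; under eq_integral do rewrite -sumEFin.
rewrite ge0_integral_sum//.
- by move=> i; exact/measurable_EFinP.
- by move=> i x _; rewrite lee_fin.
Qed.

End NonnegIntegrals.

Lemma int_cst {R : realType} (d : measure_display) (T : measurableType d)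
  (P : probability T R) (c : R) : (\int[P]_x c%:E = c%:E)%E.
Proof.
rewrite integral_cst//; transitivity (c%:E * 1)%E; last exact: mule1.
by congr (_ * _)%E; exact: probability_setT.
Qed.

(** * Product sigma-algebra and resampling of independent families *)

Section ProductLaw.
Context {R : realType} {I : finType}.

Definition box (B : I -> set R) : set (I -> R) := [set x | forall k, B k (x k)].

(** Measurable boxes generate the product sigma-algebra and are stable under intersection, so a
    finite measure on [fspace R I] is determined by its values on them. *)
Definition boxes : set (set (I -> R)) :=
  [set A | exists2 B : I -> set R, (forall k, measurable (B k)) & A = box B].

End ProductLaw.
Arguments boxes : clear implicits.
Notation fspace R I := (g_sigma_algebraType (boxes R I)).

Section Families.
Context {R : realType}.

Lemma measurable_box (I : finType) (B : I -> set R) : (forall k, measurable (B k)) ->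
  measurable (box B : set (fspace R I)).
Proof. by move=> mB; apply: sub_sigma_algebra; exists B. Qed.

Lemma measurable_coord (I : finType) (k : I) :
  measurable_fun setT (fun x : fspace R I => x k).
Proof.
move=> _ B mB; rewrite setTI.
have -> : (fun x : fspace R I => x k) @^-1` B = box (fun j => if j == k then B else setT).
  apply/seteqP; split => x /=; first by move=> Bx j; case: eqP => [->|].
  by move=> /(_ k); rewrite eqxx.
by apply: measurable_box => j; case: ifP.
Qed.

Lemma measurable_to_fspace (d : measure_display) (T : measurableType d) (I : finType)
    (f : T -> fspace R I) :
  (forall k, measurable_fun setT (fun w => f w k)) -> measurable_fun setT f.
Proof.
move=> mf; apply: (@measurability _ _ _ _ setT f (boxes R I)) => // _ [_ [B mB ->] <-].
have -> : f @^-1` box B = \bigcap_(k in [set: I]) ((fun w => f w k) @^-1` B k).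
  by apply/seteqP; split => w /= H k; move: (H k) => //; apply.
rewrite setTI; apply: fin_bigcap_measurable => // k _.
by rewrite -[X in measurable X]setTI; exact: mf.
Qed.

Lemma boxI (I : finType) (B C : I -> set R) : box B `&` box C = box (fun k => B k `&` C k).
Proof.
by apply/seteqP; split => x /= => [[H1 H2] k|H]; [split|split=> k; case: (H k)].
Qed.

Lemma boxes_unique (I : finType) (m1 m2 : {measure set (fspace R I) -> \bar R}) :
  (m1 setT < +oo)%E ->
  (forall B : I -> set R, (forall k, measurable (B k)) -> m1 (box B) = m2 (box B)) ->
  forall A, measurable A -> m1 A = m2 A.
Proof.
move=> m1oo m12 A mA.
have bT : box (fun _ : I => setT) = [set: I -> R] by apply/seteqP; split.
apply: (@g_sigma_algebra_measure_unique _ R (fspace R I) (boxes R I) _ (fun _ => setT)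
  _ _ m1 m2 _ _ _ A mA) => //.
- by move=> _ [B mB ->]; exact: measurable_box.
- by move=> _; exists (fun _ => setT).
- by rewrite bigcup_const//; exists 0%N.
- by move=> _ _ [B mB ->] [C mC ->]; exists (fun k => B k `&` C k);
    [move=> k; exact: measurableI|rewrite boxI].
- by move=> _ [B mB ->]; exact: m12.
Qed.

Definition mix (I : finType) (J : pred I) (x y : I -> R) : I -> R :=
  fun k => if J k then x k else y k.

Definition iid_family (nu : probability R R) (d : measure_display) (T : measurableType d)
    (P : probability T R) (I : finType) (X : I -> T -> R) : Prop :=
  [/\ forall k, measurable_fun setT (X k),
      forall k (B : set R), measurable B -> P (X k @^-1` B) = nu B
    & mutually_independent P X].

Section OneFamily.
Context (nu : probability R R) (d : measure_display) (T : measurableType d)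
  (P : probability T R) (I : finType) (X : I -> T -> R).
Hypothesis iidX : iid_family nu P X.

Definition sample (w : T) : fspace R I := fun k => X k w.

Lemma measurable_sample : measurable_fun setT sample.
Proof. by have [mX _ _] := iidX; exact: measurable_to_fspace. Qed.

Lemma sample_box (B : I -> set R) : (forall k, measurable (B k)) ->
  P (sample @^-1` box B) = (\prod_k nu (B k))%E.
Proof.
move=> mB; have [_ lawX indX] := iidX.
have -> : sample @^-1` box B = \bigcap_(k in [set: I]) (X k @^-1` B k).
  by apply/seteqP; split => w /= H k; move: (H k) => //; apply.
by rewrite indX//; apply: eq_bigr => k _; exact: lawX.
Qed.

Lemma measurable_mix (J : pred I) :
  measurable_fun setT (fun p : T * T => mix J (sample p.1) (sample p.2) : fspace R I).
Proof.
apply: measurable_to_fspace => k; rewrite /mix /sample; case: (J k).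
  by apply: measurableT_comp; [case: iidX|exact: measurable_fst].
by apply: measurableT_comp; [case: iidX|exact: measurable_snd].
Qed.

(* Resampling an arbitrary block of coordinates does not change the joint law;
   every use of independence below goes through this identity. *)
Lemma integral_mix (J : pred I) (f : fspace R I -> \bar R) :
  measurable_fun setT f -> (forall x, 0 <= f x)%E ->
  (\int[P]_w f (sample w) = \int[P]_w \int[P]_v f (mix J (sample w) (sample v)))%E.
Proof.
move=> mf f0.
pose p1 : {mfun T >-> fspace R I} :=
  HB.pack sample (isMeasurableFun.Build _ _ _ _ _ measurable_sample).
pose p2 : {mfun (T * T)%type >-> fspace R I} :=
  HB.pack (fun p : T * T => mix J (sample p.1) (sample p.2) : fspace R I)
    (isMeasurableFun.Build _ _ _ _ _ (@measurable_mix J)).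
have E A : measurable A -> pushforward P p1 A = pushforward (P \x P)%E p2 A.
  apply: boxes_unique.
    change (P (sample @^-1` setT) < +oo)%E.
    by rewrite preimage_setT probability_setT ltry.
  move=> B mB.
  change (P (sample @^-1` box B) =
    (P \x P)%E ((fun p : T * T => mix J (sample p.1) (sample p.2)) @^-1` box B)).
  rewrite sample_box//.
  (* Each constraint [B k] falls on exactly one of the two copies; the other copy contributes the
     factor [nu setT = 1]. *)
  pose B1 k := if J k then B k else setT; pose B2 k := if J k then setT else B k.
  have mB1 k : measurable (B1 k) by rewrite /B1; case: ifP.
  have mB2 k : measurable (B2 k) by rewrite /B2; case: ifP.
  have -> : (fun p : T * T => mix J (sample p.1) (sample p.2)) @^-1` box B =
      (sample @^-1` box B1) `*` (sample @^-1` box B2).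
    apply/seteqP; split => -[w v] /=.
      by move=> H; split => k; move: (H k); rewrite /mix /B1 /B2; case: (J k).
    by move=> [H1 H2] k; move: (H1 k) (H2 k); rewrite /mix /B1 /B2; case: (J k).
  have mp A' : measurable A' -> measurable (sample @^-1` A').
    by move=> mA'; rewrite -[X in measurable X]setTI; exact: measurable_sample.
  rewrite product_measure1E; try by apply: mp; exact: measurable_box.
  transitivity ((\prod_k nu (B1 k)) * (\prod_k nu (B2 k)))%E; last first.
    by congr (_ * _)%E; apply/esym; exact: sample_box.
  rewrite -big_split /=; apply: eq_bigr => k _.
  by rewrite /B1 /B2; case: (J k); rewrite probability_setT ?mule1 ?mul1e.
transitivity (\int[pushforward P p1]_x f x)%E.
  by rewrite ge0_integral_pushforward.
transitivity (\int[pushforward (P \x P)%E p2]_x f x)%E.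
  by apply: eq_measure_integral => A mA _; exact: E.
rewrite ge0_integral_pushforward//=; last exact: measurable_mix.
rewrite (fubini_tonelli1 (f \o p2))//=.
exact: (measurableT_comp mf (measurable_mix J)).
Qed.

Lemma integral_coord (k : I) (g : R -> \bar R) :
  measurable_fun setT g -> (forall x, 0 <= g x)%E ->
  (\int[P]_w g (sample w k) = \int[nu]_t g t)%E.
Proof.
move=> mg g0; have [mX lawX _] := iidX.
pose p1 : {mfun T >-> R} := HB.pack (X k) (isMeasurableFun.Build _ _ _ _ _ (mX k)).
transitivity (\int[pushforward P p1]_x g x)%E.
  by rewrite ge0_integral_pushforward.
by apply: eq_measure_integral => A mA _; exact: lawX.
Qed.

Definition upd (k : I) (t : R) (x : I -> R) : I -> R := fun j => if j == k then t else x j.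

Lemma measurable_upd (k : I) x : measurable_fun setT (fun t => upd k t x : fspace R I).
Proof.
apply: measurable_to_fspace => j; rewrite /upd; case: (j == k) => //; exact: measurable_id.
Qed.

Lemma integral_resample (k : I) (f : fspace R I -> \bar R) :
  measurable_fun setT f -> (forall x, 0 <= f x)%E ->
  (\int[P]_w f (sample w) = \int[P]_w \int[nu]_t f (upd k t (sample w)))%E.
Proof.
(* Every coordinate but [k] is kept, so the second copy enters only through its coordinate [k],
   whose law is [nu]. *)
move=> mf f0; rewrite (integral_mix (fun j => j != k))//.
apply: eq_integral => w _.
rewrite -(@integral_coord k (fun t => f (upd k t (sample w))))//; last first.
  exact: (measurableT_comp mf (measurable_upd k (sample w))).
apply: eq_integral => v _; congr (f _); apply/funext => j; rewrite /mix /upd.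
by case: eqP => // ->.
Qed.

End OneFamily.

Lemma iid_family_sub (nu : probability R R) (d : measure_display) (T : measurableType d)
    (P : probability T R) (I J : finType) (X : I -> T -> R) (h : J -> I) :
  injective h -> iid_family nu P X -> iid_family nu P (fun j => X (h j)).
Proof.
move=> hinj iidX; have [mX lawX indX] := iidX; split=> [j|j B mB|]; [exact: mX|exact: lawX|].
(* [C] transports [B] along [h] and is the whole line off the image, where the factors are one. *)
move=> B mB; pose C k := if [pick j | h j == k] is Some j then B j else setT.
have Ch j : C (h j) = B j.
  rewrite /C; case: pickP => [j' /eqP/hinj -> //|/(_ j)]; by rewrite eqxx.
have mC k : measurable (C k) by rewrite /C; case: pickP.
have -> : \bigcap_(k in [set: J]) (X (h k) @^-1` B k) = \bigcap_(k in [set: I]) (X k @^-1` C k).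
  apply/seteqP; split => w /= H k _.
    by rewrite /C; case: pickP => // j /eqP <-; exact: H.
  by rewrite -Ch; exact: H.
rewrite indX// (bigID (fun k => k \in imset h (mem predT))) /= [X in (_ * X)%E]big1 ?mule1; last first.
  move=> k /negP kh; rewrite /C; case: pickP => [j /eqP jk|_]; last by rewrite preimage_setT probability_setT.
  by case: kh; rewrite -jk imset_f.
rewrite big_imset /=; last by move=> x y _ _; exact: hinj.
by apply: eq_bigr => j _; rewrite Ch.
Qed.
End Families.

Ltac meas_tac := repeat (lazymatch goal with
  | |- measurable_fun _ (fun _ => ?c) => exact: measurable_cst
  | |- measurable_fun _ (fun x => x) => exact: measurable_id
  | |- measurable_fun _ (fun x => @?f x + @?g x) => apply: measurable_funD
  | |- measurable_fun _ (fun x => - @?f x) => apply: measurable_funN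
  | |- measurable_fun _ (fun x => @?f x * @?g x) => apply: measurable_funM
  | |- measurable_fun _ (fun x => @?f x ^+ _) => apply: measurable_funX
  | |- measurable_fun _ (fun x => expR (@?f x)) => apply: (measurableT_comp (@measurable_expR _))
  | |- measurable_fun _ (fun x => \sum_(i <- _ | @?P i) (@?F x i)) =>
      apply: measurable_sum_cond => ? _
  | |- measurable_fun _ _ => first [assumption | exact: measurable_coord | exact: mulrl_measurable
      | match goal with H : forall _, measurable_fun _ _ |- _ => apply: H end
      | match goal with H : forall _ _, measurable_fun _ _ |- _ => apply: H end
      | match goal with H : forall _ _ _, measurable_fun _ _ |- _ => apply: H end]
  end).

(** * One-dimensional estimates for the sub-Gaussian law *)

Section SubgaussianLaw.
Context {R : realType} (nu : probability R R).
Hypothesis subg : subgaussian nu.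

(** On the layer [k K <= |x| < (k+1) K] the integrand is at most [exp ((k+1)^2 / 4)], against a tail
    of [2 exp (- k^2)]. Since [(k+1)^2 / 4 - k^2 <= 1 - k], the layers are summable. *)
Lemma exp_square_integrable : exists K M : R, [/\ 0 < K, 0 < M
  & (\int[nu]_x (expR (x ^+ 2 / (4 * K ^+ 2)))%:E <= M%:E)%E].
Proof.
have [K [K0 tail]] := subg; exists K, (4 * expR 1); split=> //.
pose c (k : nat) : R := expR (k.+1%:R ^+ 2 / 4).
pose A (k : nat) : set R := [set x | k%:R * K <= `|x|].
have mA k : measurable (A k).
  have -> : A k = (fun x : R => `|x|) @^-1` [set` `[k%:R * K, +oo[].
    by apply/seteqP; split => x; rewrite /A/= in_itv/= andbT.
  rewrite -[X in measurable X]setTI; apply: (@normr_measurable R) => //; exact: measurable_itv.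
apply: (@le_trans _ _ (\int[nu]_x \sum_(k <oo) (c k * \1_(A k) x)%:E)%E).
  apply: ge0_le_integral => //.
  - by apply/measurable_EFinP; meas_tac.
  - apply: ge0_emeasurable_sum => [k x _ _|k _]; first by rewrite lee_fin mulr_ge0 ?expR_ge0.
    by apply/measurable_EFinP; apply: measurable_funM => //; exact: measurable_indic.
  - move=> x _; pose k := Num.truncn (`|x| / K).
    have xK : 0 <= `|x| / K by rewrite divr_ge0// ltW.
    have /andP[k1 k2] : k%:R <= `|x| / K < k.+1%:R by exact: truncn_itv.
    apply: (@le_trans _ _ (c k * \1_(A k) x)%:E); last first.
      rewrite (nneseriesD1 (n := k))//; last by move=> j _; rewrite lee_fin mulr_ge0 ?expR_ge0.
      by rewrite leeDl// nneseries_ge0// => j _ _; rewrite lee_fin mulr_ge0 ?expR_ge0.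
    rewrite indicE mem_set ?mulr1 /A/=; last by rewrite -ler_pdivlMr.
    rewrite lee_fin ler_expR.
    have -> : x ^+ 2 / (4 * K ^+ 2) = (`|x| / K) ^+ 2 / 4.
      by rewrite expr_div_n real_normK ?num_real//; field; rewrite gt_eqF.
    by rewrite ler_pM2r ?invr_gt0// ler_pXn2r ?nnegrE// ltW.
rewrite integral_nneseries//; last 2 first.
- by move=> k; apply/measurable_EFinP; apply: measurable_funM => //; exact: measurable_indic.
- by move=> k x _; rewrite lee_fin mulr_ge0 ?expR_ge0.
(* The layer [k] contributes at most [2 exp (1 - k)], hence at most [4 e / 2^(k+1)] by
   [2^k <= exp k]; this geometric series sums to [4 e]. *)
apply: le_trans (epsilon_trick0 xpredT _); last by rewrite mulr_ge0 ?expR_ge0.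
apply: lee_nneseries => [k _ _|k _]; first by apply: integral_ge0 => x _; rewrite lee_fin mulr_ge0 ?expR_ge0.
rewrite intZ; [|exact: measurable_indic|by []|exact: expR_ge0].
rewrite integral_indic// setIT.
apply: (@le_trans _ _ ((c k)%:E * (2 * expR (- (k%:R * K) ^+ 2 / K ^+ 2))%:E)%E).
  by apply: lee_wpmul2l; [rewrite lee_fin expR_ge0|apply: tail; rewrite mulr_ge0// ltW].
rewrite -EFinM lee_fin ler_pdivlMr ?ltr0n ?expn_gt0// natrX exprS.
have -> : - (k%:R * K) ^+ 2 / K ^+ 2 = - (k%:R ^+ 2) by field; rewrite gt_eqF.
have h2 : 2 ^+ k <= expR k%:R :> R.
  rewrite -[k%:R]mulr1 expRM_natl; apply: lerXn2r; rewrite ?nnegrE ?expR_ge0//.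
  by have := expR_ge1Dx (1 : R); lra.
have h3 : c k * expR (- (k%:R ^+ 2)) * expR k%:R <= expR 1.
  rewrite -!expRD ler_expR -natr1; move: (k%:R : R) => y.
  have := sqr_ge0 (y - 1); lra.
have c0 : 0 <= c k * expR (- (k%:R ^+ 2)) by rewrite mulr_ge0 ?expR_ge0.
apply: (@le_trans _ _ (4 * (c k * expR (- (k%:R ^+ 2)) * expR k%:R))); last by rewrite ler_pM2l.
rewrite [2 ^+ k.+1]exprS; have := ler_wpM2l c0 h2.
move: (c k) (expR (- (k%:R ^+ 2))) (expR k%:R) (2 ^+ k) => a b e f; lra.
Qed.

(** Domination by [1 + x^8], and of the eighth power by the exponential. Order eight is what the
    fourth power of [sum x_j^2] requires. *)
Lemma integrable_pow (j : nat) : (j <= 8)%N -> nu.-integrable setT (fun x => (x ^+ j)%:E).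
Proof.
move=> j8; have [K [M [K0 M0 hM]]] := exp_square_integrable.
pose C := 1 + (4 * K ^+ 2) ^+ 4 * 24.
have C0 : 0 < C by rewrite /C ltr_pwDl// mulr_ge0// exprn_ge0// mulr_ge0// sqr_ge0.
apply: (@le_integrable _ _ R nu setT measurableT _ (fun x => (C * expR (x ^+ 2 / (4 * K ^+ 2)))%:E)) => //.
- by apply/measurable_EFinP; exact: measurable_funX.
- move=> x _; rewrite /= lee_fin normrX [leRHS]ger0_norm ?mulr_ge0 ?expR_ge0//; last exact: ltW.
  set y := x ^+ 2 / (4 * K ^+ 2).
  have y0 : 0 <= y by rewrite divr_ge0 ?sqr_ge0// mulr_ge0// sqr_ge0.
  have h : `|x| ^+ 8 = (4 * K ^+ 2) ^+ 4 * y ^+ 4.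
    rewrite -exprMn /y mulrC divfK; last by rewrite mulf_neq0 ?sqrf_eq0 ?gt_eqF.
    by rewrite -(real_normK (num_real x)) -exprM.
  have h1 : `|x| ^+ j <= 1 + `|x| ^+ 8.
    have [x1|x1] := leP `|x| 1.
      by rewrite (le_trans (exprn_ile1 j (normr_ge0 _) x1))// lerDl exprn_ge0.
    by rewrite (le_trans (ler_weXn2l (ltW x1) j8))// lerDr.
  have h4 : y ^+ 4 <= 24 * expR y.
    have := expR_ge1Dxn 3 y0; rewrite (_ : (4`!)%:R = 24 :> R)//.
    by move=> h4; lra.
  apply: (le_trans h1); rewrite h /C.
  have c0 : 0 <= (4 * K ^+ 2) ^+ 4 by rewrite exprn_ge0// mulr_ge0// sqr_ge0.
  have := ler_wpM2l c0 h4; have := expR_ge1Dx y; lra.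
- apply/integrableP; split.
    apply/measurable_EFinP; apply: measurable_funM => //; apply: measurableT_comp => //.
    by apply: measurable_funM => //; exact: measurable_funX.
  under eq_integral => x _ do rewrite /= ger0_norm ?mulr_ge0 ?expR_ge0 ?(ltW C0)//.
  rewrite intZ; [|meas_tac|by move=> x; exact: expR_ge0|exact: ltW].
  by rewrite lte_mul_pinfty ?lee_fin ?(ltW C0)// (le_lt_trans hM)// ltry.
Qed.

(** The linear term is isolated so that a zero mean removes it. Beyond [1/2] one has [y <= 2 y^2];
    below, [exp y <= 1 / (1 - y)] is compared with [1 + y + 2 y^2]. *)
Lemma exp_le_add_exp_sqr (y : R) : expR y <= y + expR (2 * y ^+ 2).
Proof.
have [y2|y2] := leP y (1/2); last first.
  have : expR y <= expR (2 * y ^+ 2) by rewrite ler_expR; nra.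
  lra.
have y1 : 0 < 1 - y by lra.
have h1 : expR y * (1 - y) <= 1.
  have := expR_ge1Dx (- y); have := expR_gt0 y; have : expR y * expR (- y) = 1 by rewrite -expRD subrr expR0.
  nra.
have h2 := expR_ge1Dx (2 * y ^+ 2).
have : expR y * (1 - y) <= (1 + y + 2 * y ^+ 2) * (1 - y).
  have : 0 <= y ^+ 2 * (1 - 2 * y) by apply: mulr_ge0; [exact: sqr_ge0|lra].
  lra.
rewrite ler_pM2r//; lra.
Qed.

(** Convexity of the exponential between 0 and [y], obtained from its tangent at [a y]. *)
Lemma exp_convex_le (a y : R) : 0 <= a -> a <= 1 -> expR (a * y) <= 1 + a * expR y.
Proof.
move=> a0 a1.
have h1 := expR_ge1Dx ((1 - a) * y); have h2 := expR_ge1Dx (- (a * y)).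
have e1 : expR y = expR (a * y) * expR ((1 - a) * y) by rewrite -expRD; congr expR; ring.
have e2 : expR (a * y) * expR (- (a * y)) = 1 by rewrite -expRD subrr expR0.
have p := expR_gt0 (a * y).
have g1 : expR (a * y) * (1 + (1 - a) * y) <= expR y by rewrite e1 ler_pM2l.
have g2 : expR (a * y) * (1 - a * y) <= 1 by rewrite -[leRHS]e2 ler_pM2l.
have k1 := ler_wpM2l a0 g1.
have k2 : (1 - a) * (expR (a * y) * (1 - a * y)) <= (1 - a) * 1.
  by apply: ler_wpM2l => //; rewrite subr_ge0.
have -> : expR (a * y) = a * (expR (a * y) * (1 + (1 - a) * y)) +
    (1 - a) * (expR (a * y) * (1 - a * y)) by ring.
move: k1 k2 a0; move: (expR y) (expR (a * y) * (1 + (1 - a) * y)) (expR (a * y) * (1 - a * y)) => E A B.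
lra.
Qed.

Hypothesis mean0 : (\int[nu]_x (x%:E) = 0)%E.

(** For small [t] the linear term integrates to zero, and convexity scales [exp (2 t^2 x^2)] down to
    the integrable [exp (x^2 / q)] with weight [2 q t^2 <= 1]. For large [t] the crude bound already
    suffices, because [2 q t^2 > 1] lets the prefactor [M] move into the exponent. *)
Lemma mgf_bound : exists2 C : R, 0 < C &
  forall t : R, (\int[nu]_x (expR (t * x))%:E <= (expR (C * t ^+ 2))%:E)%E.
Proof.
have [K [M [K0 M0 hM]]] := exp_square_integrable.
have mS (b : R) : measurable_fun setT (fun x : R => expR (b * x ^+ 2)) by meas_tac.
have mE (b : R) : measurable_fun setT (fun x : R => expR (b * x)) by meas_tac.
have hM' : (\int[nu]_x (expR ((4 * K ^+ 2)^-1 * x ^+ 2))%:E <= M%:E)%E.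
  by under eq_integral do rewrite mulrC.
set q := 4 * K ^+ 2 in hM hM'; have q0 : 0 < q by rewrite mulr_gt0// exprn_gt0.
pose a (t : R) := 2 * q * t ^+ 2.
exists (q + 2 * q * M); first by rewrite addr_gt0// !mulr_gt0.
move=> t; have t2 : 0 <= t ^+ 2 by exact: sqr_ge0.
have crude : (\int[nu]_x (expR (t * x))%:E <= (expR (q * t ^+ 2) * M)%:E)%E.
  apply: (@le_trans _ _ (\int[nu]_x (expR (q * t ^+ 2) * expR (q^-1 * x ^+ 2))%:E)%E).
    apply: int_le; [meas_tac|meas_tac|by move=> x; exact: expR_ge0|move=> x].
    rewrite -expRD ler_expR.
    have h : 0 <= q^-1 * (x - q * t / 2) ^+ 2 by rewrite mulr_ge0 ?sqr_ge0// invr_ge0 ltW.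
    have e : q^-1 * (x - q * t / 2) ^+ 2 = q^-1 * x ^+ 2 - t * x + q * t ^+ 2 / 4.
      by field; rewrite gt_eqF.
    have : 0 <= q * t ^+ 2 by rewrite mulr_ge0// ltW.
    by rewrite e in h; lra.
  rewrite intZ; [|meas_tac|by move=> x; exact: expR_ge0|exact: expR_ge0].
  by rewrite EFinM; apply: lee_wpmul2l => //; rewrite lee_fin expR_ge0.
have [small|large] := leP (a t) 1; last first.
  apply: (le_trans crude); rewrite lee_fin mulrDl expRD.
  apply: ler_wpM2l; first exact: expR_ge0.
  apply: (@le_trans _ _ (expR M)); first by have := expR_ge1Dx M; lra.
  by rewrite ler_expR mulrAC ler_peMl// ltW.
have a0 : 0 <= a t by rewrite /a mulr_ge0// mulr_ge0// ltW.
have iE : nu.-integrable setT (fun x => (expR (t * x))%:E).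
  apply/integrableP; split; first by apply/measurable_EFinP; meas_tac.
  under eq_integral => x _ do rewrite /= ger0_norm ?expR_ge0//.
  by rewrite (le_lt_trans crude)// ltry.
have iS : nu.-integrable setT (fun x => (expR (q^-1 * x ^+ 2))%:E).
  apply/integrableP; split; first by apply/measurable_EFinP; meas_tac.
  under eq_integral => x _ do rewrite /= ger0_norm ?expR_ge0//.
  by rewrite (le_lt_trans hM')// ltry.
have i1 : nu.-integrable setT (fun x => (t%:E * x%:E)%E).
  by apply: integrableZl => //; have := @integrable_pow 1 isT.
have i2 : nu.-integrable setT (fun x => ((a t)%:E * (expR (q^-1 * x ^+ 2))%:E)%E).
  exact: integrableZl.
have ic : nu.-integrable setT (fun=> 1%E : \bar R).
  by have := @integrable_pow 0 isT.
apply: (@le_trans _ _ (\int[nu]_x ((t%:E * x%:E) + (1 + (a t)%:E * (expR (q^-1 * x ^+ 2))%:E)))%E).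
  apply: le_integral => //; first by apply: integrableD => //; exact: integrableD.
  move=> x _; rewrite -!EFinM -!EFinD lee_fin.
  apply: (le_trans (exp_le_add_exp_sqr _)); rewrite lerD2l.
  have -> : 2 * (t * x) ^+ 2 = a t * (q^-1 * x ^+ 2) by rewrite /a; field; rewrite gt_eqF.
  exact: exp_convex_le.
rewrite integralD//; last exact: integrableD.
rewrite integralZl//; last by have := @integrable_pow 1 isT.
rewrite mean0 mule0 add0e integralD// int_cst.
rewrite integralZl//.
apply: (@le_trans _ _ (1 + (a t)%:E * M%:E)%E).
  by rewrite leeD2l//; apply: lee_wpmul2l => //; rewrite lee_fin.
rewrite -EFinM -EFinD lee_fin; apply: (le_trans (expR_ge1Dx _)); rewrite ler_expR /a.
have : 0 <= q * t ^+ 2 by rewrite mulr_ge0// ltW.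
lra.
Qed.

Hypothesis var1 : (\int[nu]_x ((x ^+ 2)%:E) = 1)%E.

Definition moment (j : nat) : R := fine (\int[nu]_x ((x ^+ j)%:E))%E.

Lemma momentE j : (j <= 8)%N -> (\int[nu]_x ((x ^+ j)%:E) = (moment j)%:E)%E.
Proof.
by move=> j8; rewrite /moment fineK//; apply: integrable_fin_num => //; exact: integrable_pow.
Qed.

Lemma integral_quartic (c0 c1 c2 c3 c4 : R) :
  (\int[nu]_x (c0 + c1 * x + c2 * x ^+ 2 + c3 * x ^+ 3 + c4 * x ^+ 4)%:E
   = (c0 + c2 + c3 * moment 3 + c4 * moment 4)%:E)%E.
Proof.
have iX j c : (j <= 8)%N -> nu.-integrable setT (fun x => (c%:E * (x ^+ j)%:E)%E).
  by move=> j8; apply: integrableZl => //; exact: integrable_pow.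
have IX j c : (j <= 8)%N -> (\int[nu]_x (c%:E * (x ^+ j)%:E) = (c * moment j)%:E)%E.
  by move=> j8; rewrite integralZl//; [rewrite momentE|exact: integrable_pow].
have m0 : moment 0 = 1 by rewrite /moment; under eq_integral do rewrite expr0; rewrite int_cst.
have m1 : moment 1 = 0 by rewrite /moment mean0.
have m2 : moment 2 = 1 by rewrite /moment var1.
transitivity (\int[nu]_x (c0%:E * (x ^+ 0)%:E + (c1%:E * (x ^+ 1)%:E + (c2%:E * (x ^+ 2)%:E
    + (c3%:E * (x ^+ 3)%:E + c4%:E * (x ^+ 4)%:E)))))%E.
  by apply: eq_integral => x _; rewrite expr0 mule1 expr1 -!EFinM -!EFinD !addrA.
have i3 : nu.-integrable setT (fun x => c3%:E * (x ^+ 3)%:E + c4%:E * (x ^+ 4)%:E)%E.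
  by apply: integrableD => //; exact: iX.
have i2 : nu.-integrable setT (fun x => c2%:E * (x ^+ 2)%:E + (c3%:E * (x ^+ 3)%:E + c4%:E * (x ^+ 4)%:E))%E.
  by apply: integrableD => //; exact: iX.
have i1 : nu.-integrable setT (fun x => c1%:E * (x ^+ 1)%:E + (c2%:E * (x ^+ 2)%:E + (c3%:E * (x ^+ 3)%:E + c4%:E * (x ^+ 4)%:E)))%E.
  by apply: integrableD => //; exact: iX.
rewrite (integralD _ (iX 0 c0 isT) i1)// (integralD _ (iX 1 c1 isT) i2)//.
rewrite (integralD _ (iX 2 c2 isT) i3)// (integralD _ (iX 3 c3 isT) (iX 4 c4 isT))//.
by rewrite !IX// m0 m1 m2 -!EFinD mulr0 !mulr1 add0r !addrA.
Qed.

Lemma integral_affine_sqr (a b : R) : (\int[nu]_x ((a + b * x) ^+ 2)%:E = (a ^+ 2 + b ^+ 2)%:E)%E.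
Proof.
transitivity (\int[nu]_x (a ^+ 2 + 2 * a * b * x + b ^+ 2 * x ^+ 2 + 0 * x ^+ 3 + 0 * x ^+ 4)%:E)%E.
  by apply: eq_integral => x _; congr EFin; ring.
by rewrite integral_quartic !mul0r !addr0.
Qed.

Lemma integral_quadratic_sqr (a b c : R) :
  (\int[nu]_x ((a + b * x + c * x ^+ 2) ^+ 2)%:E =
   ((a + c) ^+ 2 + b ^+ 2 + 2 * b * c * moment 3 + c ^+ 2 * (moment 4 - 1))%:E)%E.
Proof.
transitivity (\int[nu]_x (a ^+ 2 + 2 * a * b * x + (b ^+ 2 + 2 * a * c) * x ^+ 2
    + 2 * b * c * x ^+ 3 + c ^+ 2 * x ^+ 4)%:E)%E.
  by apply: eq_integral => x _; congr EFin; ring.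
by rewrite integral_quartic; congr EFin; ring.
Qed.

(** Cauchy-Schwarz for [x] and [x^2 - 1], read off the nonnegative integral of
    [(x^2 - m3 x - 1)^2]. *)
Lemma skewness_le : moment 3 ^+ 2 <= moment 4 - 1.
Proof.
have : (0 <= \int[nu]_x ((- 1 + (- moment 3) * x + 1 * x ^+ 2) ^+ 2)%:E)%E.
  by apply: int_ge0 => x; exact: sqr_ge0.
rewrite integral_quadratic_sqr lee_fin; lra.
Qed.

Hypothesis mom4 : (\int[nu]_x ((x ^+ 4)%:E) <= 3%:E)%E.

(** The cubic term [4 a b^3 x^3] is absorbed by [2 (a b x - b^2 x^2)^2 >= 0], which raises the
    coefficients 6 and 1 to 8 and 3; the fourth moment bound 3 then gives 9. *)
Lemma integral_affine_pow4 (a b : R) :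
  (\int[nu]_x ((a + b * x) ^+ 4)%:E <= (a ^+ 4 + 8 * (a ^+ 2 * b ^+ 2) + 9 * b ^+ 4)%:E)%E.
Proof.
have m4 : moment 4 <= 3 by rewrite -lee_fin -momentE.
apply: (@le_trans _ _ (\int[nu]_x (a ^+ 4 + 4 * a ^+ 3 * b * x + 8 * (a ^+ 2 * b ^+ 2) * x ^+ 2
    + 0 * x ^+ 3 + 3 * b ^+ 4 * x ^+ 4)%:E)%E).
  apply: int_le; [meas_tac|meas_tac|by move=> x; exact: exprn_even_ge0|move=> x].
  have := sqr_ge0 (a * (b * x) - (b * x) ^+ 2); lra.
rewrite integral_quartic lee_fin mul0r addr0 lerD2l.
have : 0 <= b ^+ 4 by exact: exprn_even_ge0.
nra.
Qed.

End SubgaussianLaw.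

(** * Triangular decomposition of quadratic forms and predictable coefficients *)

Section Below.
Context {R : realType} (n : nat).

Lemma sum_below_recr (k : 'I_n) (F : 'I_n -> R) :
  \sum_(j < n | (j < k.+1)%N) F j = \sum_(j < n | (j < k)%N) F j + F k.
Proof.
rewrite (bigD1 k) /= ?ltnS// addrC; congr (_ + _); apply: eq_bigl => j.
by rewrite -val_eqE /=; lia.
Qed.

Lemma sum_below_all (F : 'I_n -> R) : \sum_(j < n | (j < n)%N) F j = \sum_j F j.
Proof. by apply: eq_bigl => j; rewrite ltn_ord. Qed.

Lemma sum_below0 (F : 'I_n -> R) : \sum_(j < n | (j < 0)%N) F j = 0.
Proof. by rewrite big_pred0. Qed.

Lemma sum_sym_pairs (F : 'I_n -> 'I_n -> R) :
  \sum_j \sum_k F j k = \sum_j (F j j + \sum_(k < n | (k < j)%N) (F j k + F k j)).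
Proof.
transitivity (\sum_j (F j j + \sum_(k < n | (k < j)%N) F j k + \sum_(k < n | (j < k)%N) F j k)).
  apply: eq_bigr => j _; rewrite (bigD1 j)//= -addrA; congr (_ + _).
  rewrite (bigID (fun k : 'I_n => (k < j)%N)) /=; congr (_ + _); apply: eq_bigl => k;
    by rewrite -val_eqE /=; lia.
rewrite !big_split /=.
have -> : \sum_(j < n) \sum_(k < n | (k < j)%N) (F j k + F k j) =
    \sum_(j < n) \sum_(k < n | (k < j)%N) F j k + \sum_(j < n) \sum_(k < n | (k < j)%N) F k j.
  by rewrite -big_split /=; apply: eq_bigr => j _; rewrite big_split.
rewrite addrA; congr (_ + _).
by rewrite (exchange_big_dep predT).
Qed.

(** Dependence on the coordinates below [j] only, expressed as invariance under changing any
    coordinate [k >= j]. This is the form in which one-coordinate resampling uses it, without a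
    filtration. *)
Definition predictable (v : 'I_n -> ('I_n -> R) -> R) : Prop :=
  forall (j k : 'I_n) t x, (j <= k)%N -> v j (upd k t x) = v j x.

Lemma upd_same (k : 'I_n) t (x : 'I_n -> R) : upd k t x k = t.
Proof. by rewrite /upd eqxx. Qed.

Lemma upd_below (k j : 'I_n) t (x : 'I_n -> R) : (j < k)%N -> upd k t x j = x j.
Proof. by rewrite /upd; case: eqP => // ->; rewrite ltnn. Qed.

Lemma sum_below_upd (g : 'I_n -> R -> R -> R) v (k : 'I_n) t x : predictable v ->
  \sum_(j < n | (j < k)%N) g j (upd k t x j) (v j (upd k t x)) =
  \sum_(j < n | (j < k)%N) g j (x j) (v j x).
Proof.
by move=> pv; apply: eq_bigr => j jk; rewrite upd_below// pv// ltnW.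
Qed.

Definition lower (U : 'I_n -> 'I_n -> R) (j : 'I_n) (x : 'I_n -> R) : R :=
  \sum_(k < n | (k < j)%N) U j k * x k.

Definition lowersq (U : 'I_n -> 'I_n -> R) (j : 'I_n) : R :=
  \sum_(k < n | (k < j)%N) U j k ^+ 2.

Lemma lowersq_ge0 U j : 0 <= lowersq U j.
Proof. by apply: sumr_ge0 => k _; exact: sqr_ge0. Qed.

Lemma predictable_lower U : predictable (lower U).
Proof.
by move=> j k t x jk; apply: eq_bigr => i ij; rewrite upd_below// (leq_trans ij).
Qed.

Lemma measurable_lower U j : measurable_fun setT (lower U j : fspace R 'I_n -> R).
Proof. by rewrite /lower; meas_tac. Qed.

Definition qform (U : 'M[R]_n) (x : 'I_n -> R) : R := \sum_j \sum_k x j * U j k * x k.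

Lemma qform_lower (U : 'M[R]_n) h x : U^T = U -> (forall j, U j j = h) ->
  qform U x = \sum_j (h * x j ^+ 2 + 2 * (x j * lower U j x)).
Proof.
move=> Us Ud; rewrite /qform sum_sym_pairs; apply: eq_bigr => j _.
rewrite Ud /lower !mulr_sumr; congr (_ + _); first by ring.
apply: eq_bigr => k _; rewrite (_ : U k j = U j k); first by ring.
by rewrite -[in LHS]Us mxE.
Qed.

(** The right side is the lower bound for the second moment of the form; the constant diagonal
    enters it as the squared mean [n^2 h^2], which dominates [n h^2]. *)
Lemma sqn_lower (U : 'M[R]_n) h : U^T = U -> (forall j, U j j = h) ->
  sqn U <= n%:R ^+ 2 * h ^+ 2 + 4 * \sum_j lowersq U j.
Proof.
move=> Us Ud; rewrite /sqn sum_sym_pairs big_split /=.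
have -> : \sum_(i < n) \sum_(k < n | (k < i)%N) (U i k ^+ 2 + U k i ^+ 2) = 2 * \sum_j lowersq U j.
  rewrite mulr_sumr; apply: eq_bigr => j _; rewrite /lowersq mulr_sumr; apply: eq_bigr => k _.
  rewrite (_ : U k j = U j k); first by ring.
  by rewrite -[in LHS]Us mxE.
under eq_bigr do rewrite Ud.
rewrite sumr_const card_ord -mulr_natl.
have A0 : 0 <= \sum_j lowersq U j by apply: sumr_ge0 => j _; exact: lowersq_ge0.
have : n%:R * h ^+ 2 <= n%:R ^+ 2 * h ^+ 2.
  by rewrite ler_wpM2r ?sqr_ge0// -natrX ler_nat; case: (n) => // k; rewrite expnS leq_pmulr// expn_gt0.
lra.
Qed.

End Below.

Definition Expect {R : realType} (d : measure_display) (T : measurableType d)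
    (P : probability T R) (I : finType) (X : I -> T -> R) (f : fspace R I -> R) : \bar R :=
  (\int[P]_w (f (sample X w))%:E)%E.
Arguments Expect {R d T} P {I} X f%_R.

(** * Moments and exponential moments of linear forms and chaoses *)

Section Processes.
Context {R : realType} (nu : probability R R).
Context (d : measure_display) (T : measurableType d) (P : probability T R).
Context (n : nat) (X : 'I_n -> T -> R).
Hypothesis iidX : iid_family nu P X.
Local Notation F := (fspace R 'I_n).
Local Notation Ex f := (Expect P X f%R).

Lemma measurable_on_sample (f : F -> R) : measurable_fun setT f ->
  measurable_fun setT (fun w => f (sample X w)).
Proof. by move=> mf; exact: (measurableT_comp mf (measurable_sample iidX)). Qed.

Lemma Ex_eq (f g : F -> R) : (forall x, f x = g x) -> Ex f = Ex g.
Proof. by move=> fg; congr (Expect P X _); apply/funext. Qed.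

Lemma Ex_cst (c : R) : (Ex (fun _ : F => c) = c%:E)%E.
Proof. exact: int_cst. Qed.

Lemma Ex_le (f g : F -> R) : measurable_fun setT f -> measurable_fun setT g ->
  (forall x, 0 <= f x) -> (forall x, f x <= g x) -> (Ex f <= Ex g)%E.
Proof. by move=> mf mg f0 fg; apply: int_le => //; exact: measurable_on_sample. Qed.

Lemma ExD (f g : F -> R) : measurable_fun setT f -> measurable_fun setT g ->
  (forall x, 0 <= f x) -> (forall x, 0 <= g x) -> (Ex (fun x => f x + g x)%R = Ex f + Ex g)%E.
Proof. by move=> mf mg f0 g0; apply: intD => //; exact: measurable_on_sample. Qed.

Lemma ExZ (c : R) (f : F -> R) : measurable_fun setT f -> (forall x, 0 <= f x) -> 0 <= c ->
  (Ex (fun x => c * f x)%R = c%:E * Ex f)%E.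
Proof. by move=> mf f0 c0; apply: intZ => //; exact: measurable_on_sample. Qed.

Lemma Ex_sum (J : finType) (g : J -> F -> R) : (forall i, measurable_fun setT (g i)) ->
  (forall i x, 0 <= g i x) -> (Ex (fun x => \sum_i g i x)%R = \sum_i Ex (g i))%E.
Proof.
move=> mg g0; rewrite /Expect int_sum// => i; exact: measurable_on_sample.
Qed.

Lemma measurable_resample (k : 'I_n) (f : F -> \bar R) : measurable_fun setT f ->
  (forall x, 0 <= f x)%E ->
  measurable_fun setT (fun w => \int[nu]_t f (upd k t (sample X w)))%E.
Proof.
move=> mf f0; have [mX _ _] := iidX.
have mu2 : measurable_fun setT (fun p : T * R => upd k p.2 (sample X p.1) : F).
  apply: measurable_to_fspace => j; rewrite /upd /sample; case: (j == k).
    exact: measurable_snd.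
  by apply: measurableT_comp; [exact: mX|exact: measurable_fst].
apply: (@measurable_fun_fubini_tonelli_F _ _ T R R nu
  (fun p : T * R => f (upd k p.2 (sample X p.1)))) => //.
exact: (measurableT_comp mf mu2).
Qed.

(** Stands in for conditioning on all coordinates but [k]: a pointwise bound after integrating out
    one coordinate passes to the expectation. *)
Lemma step_le (k : 'I_n) (f G : F -> R) : measurable_fun setT f -> measurable_fun setT G ->
  (forall x, 0 <= f x) -> (forall x, (\int[nu]_t (f (upd k t x))%:E <= (G x)%:E)%E) ->
  (Ex f <= Ex G)%E.
Proof.
move=> mf mG f0 fG.
have mf' : measurable_fun setT (EFin \o f) by exact/measurable_EFinP.
have f0' x : (0 <= (EFin \o f) x)%E by rewrite lee_fin.
rewrite /Expect (integral_resample iidX k (f := EFin \o f))//.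
apply: ge0_le_integral => //.
- by move=> w _; apply: integral_ge0 => t _; rewrite lee_fin.
- exact: measurable_resample.
- by apply/measurable_EFinP; exact: measurable_on_sample.
- by move=> w _; exact: fG.
Qed.

Lemma step_ge (k : 'I_n) (f G : F -> R) : measurable_fun setT f -> measurable_fun setT G ->
  (forall x, 0 <= f x) -> (forall x, 0 <= G x) ->
  (forall x, ((G x)%:E <= \int[nu]_t (f (upd k t x))%:E)%E) ->
  (Ex G <= Ex f)%E.
Proof.
move=> mf mG f0 G0 fG.
have mf' : measurable_fun setT (EFin \o f) by exact/measurable_EFinP.
have f0' x : (0 <= (EFin \o f) x)%E by rewrite lee_fin.
rewrite /Expect (integral_resample iidX k (f := EFin \o f))//.
apply: ge0_le_integral => //.
- by move=> w _; rewrite lee_fin.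
- by apply/measurable_EFinP; exact: measurable_on_sample.
- exact: measurable_resample.
Qed.

(** Given the earlier coordinates, the last increment has exponential moment at most [exp (C v^2)],
    exactly what its compensator removes; coordinates are peeled off from the top. *)
Lemma exp_supermartingale (C : R) (v : 'I_n -> F -> R) :
  (forall t : R, (\int[nu]_x (expR (t * x))%:E <= (expR (C * t ^+ 2))%:E)%E) ->
  (forall j, measurable_fun setT (v j)) -> predictable v ->
  (Ex (fun x : F => expR (\sum_j (x j * v j x - C * v j x ^+ 2))) <= 1)%E.
Proof.
move=> mgf mv pv.
suff H p : (p <= n)%N ->
    (Ex (fun x : F => expR (\sum_(j < n | (j < p)%N) (x j * v j x - C * v j x ^+ 2))) <= 1)%E.
  apply: le_trans (H n (leqnn n)); rewrite le_eqVlt; apply/orP; left; apply/eqP.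
  by apply: Ex_eq => x; rewrite sum_below_all.
elim: p => [_|p IH pn].
  by rewrite (@Ex_eq _ (fun=> 1)) ?Ex_cst// => x; rewrite sum_below0 expR0.
apply: le_trans (IH (ltnW pn)).
pose k := Ordinal pn.
apply: (step_le (k := k)); [by meas_tac|by meas_tac|by move=> x; exact: expR_ge0|move=> x].
pose S := \sum_(j < n | (j < k)%N) (x j * v j x - C * v j x ^+ 2).
under eq_integral => t _.
  rewrite (sum_below_recr k) (sum_below_upd (fun _ a b => a * b - C * b ^+ 2) k t x pv).
  rewrite upd_same pv// -/S (_ : S + (t * v k x - C * v k x ^+ 2) =
    (S - C * v k x ^+ 2) + v k x * t); last by ring.
  rewrite expRD.
  over.
rewrite intZ; [|by meas_tac|by move=> t; exact: expR_ge0|exact: expR_ge0].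
apply: (@le_trans _ _ ((expR (S - C * v k x ^+ 2))%:E * (expR (C * v k x ^+ 2))%:E)%E).
  by apply: lee_wpmul2l => //; rewrite lee_fin expR_ge0.
by rewrite -EFinM lee_fin -expRD subrK.
Qed.

Lemma exp_linear_le1 (C : R) (c : 'I_n -> R) :
  (forall t : R, (\int[nu]_x (expR (t * x))%:E <= (expR (C * t ^+ 2))%:E)%E) ->
  (Ex (fun x : F => expR (\sum_j c j * x j - C * \sum_j c j ^+ 2)) <= 1)%E.
Proof.
move=> mgf; have := @exp_supermartingale C (fun j _ => c j) mgf.
move=> /(_ (fun j => measurable_cst _)) /(_ _)/wrap[//|].
congr (_ <= _)%E; apply: Ex_eq => x; congr (expR _).
by rewrite mulr_sumr -sumrB; apply: eq_bigr => j _; rewrite mulrC.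
Qed.

Hypothesis subg : subgaussian nu.
Hypothesis mean0 : (\int[nu]_x (x%:E) = 0)%E.
Hypothesis var1 : (\int[nu]_x ((x ^+ 2)%:E) = 1)%E.
Hypothesis mom4 : (\int[nu]_x ((x ^+ 4)%:E) <= 3%:E)%E.

Lemma linear_second_moment (a : R) (c : 'I_n -> R) (p : nat) : (p <= n)%N ->
  (Ex (fun x : F => (a + \sum_(j < n | (j < p)%N) c j * x j) ^+ 2)
   = (a ^+ 2 + \sum_(j < n | (j < p)%N) c j ^+ 2)%:E)%E.
Proof.
elim: p => [_|p IH pn].
  by rewrite (@Ex_eq _ (fun=> a ^+ 2)) ?Ex_cst ?sum_below0 ?addr0// => x; rewrite sum_below0 addr0.
pose k := Ordinal pn; rewrite (sum_below_recr k) addrA EFinD -(IH (ltnW pn)).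
rewrite -(Ex_cst (c k ^+ 2)) -(@ExD _ (fun=> c k ^+ 2));
  [|by meas_tac|by meas_tac|by move=> x; exact: sqr_ge0|by move=> x; exact: sqr_ge0].
have E x : (\int[nu]_t ((a + \sum_(j < n | (j < p.+1)%N) c j * (upd k t x) j) ^+ 2)%:E =
    ((a + \sum_(j < n | (j < p)%N) c j * x j) ^+ 2 + c k ^+ 2)%:E)%E.
  under eq_integral => t _.
    rewrite (sum_below_recr k) (@sum_below_upd _ _ (fun j a _ => c j * a) (fun _ _ => 0) k t x)//.
    rewrite upd_same addrA.
    over.
  by rewrite integral_affine_sqr.
apply/eqP; rewrite eq_le; apply/andP; split.
  by apply: (step_le (k := k)); [by meas_tac|by meas_tac|by move=> x; exact: sqr_ge0|move=> x]; rewrite E.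
apply: (step_ge (k := k)); [by meas_tac|by meas_tac|by move=> x; exact: sqr_ge0
  |by move=> x; rewrite addr_ge0 ?sqr_ge0|by move=> x; rewrite E].
Qed.

Lemma linear_fourth_moment (c : 'I_n -> R) (p : nat) : (p <= n)%N ->
  (Ex (fun x : F => (\sum_(j < n | (j < p)%N) c j * x j) ^+ 4)
   <= (9 * (\sum_(j < n | (j < p)%N) c j ^+ 2) ^+ 2)%:E)%E.
Proof.
elim: p => [_|p IH pn].
  by rewrite (@Ex_eq _ (fun=> 0)) ?Ex_cst ?sum_below0 ?expr0n ?mulr0// => x; rewrite sum_below0 expr0n.
pose k := Ordinal pn; rewrite (sum_below_recr k).
set A := \sum_(j < n | (j < k)%N) c j ^+ 2.
have A0 : 0 <= A by apply: sumr_ge0 => j _; exact: sqr_ge0.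
pose M (x : F) := \sum_(j < n | (j < k)%N) c j * x j.
have mM : measurable_fun setT M by rewrite /M; meas_tac.
apply: (@le_trans _ _ (Ex (fun x => M x ^+ 4 + (8 * c k ^+ 2 * M x ^+ 2 + 9 * c k ^+ 4)))).
  apply: (step_le (k := k)); [by meas_tac|by meas_tac|by move=> x; exact: exprn_even_ge0|move=> x].
  under eq_integral => t _.
    rewrite (sum_below_recr k) (@sum_below_upd _ _ (fun j a _ => c j * a) (fun _ _ => 0) k t x)//.
    rewrite upd_same -/(M x).
    over.
  apply: le_trans (integral_affine_pow4 _ _ _ _ _ _) _ => //.
  by rewrite lee_fin -/(M x); lra.
have g1 x : 0 <= 8 * c k ^+ 2 * M x ^+ 2 by rewrite mulr_ge0 ?sqr_ge0// mulr_ge0 ?sqr_ge0.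
have g2 : 0 <= 9 * c k ^+ 4 by rewrite mulr_ge0// exprn_even_ge0.
rewrite ExD; [|by meas_tac|by meas_tac|by move=> x; exact: exprn_even_ge0|by move=> x; rewrite addr_ge0].
rewrite ExD; [|by meas_tac|by meas_tac|by []|by []].
rewrite ExZ; [|by meas_tac|by move=> x; exact: sqr_ge0|by rewrite mulr_ge0 ?sqr_ge0].
rewrite Ex_cst.
have -> : (Ex (fun x : F => M x ^+ 2) = A%:E)%E.
  have := linear_second_moment 0 c (ltnW pn); rewrite expr0n add0r => <-.
  by apply: Ex_eq => x; rewrite add0r.
apply: (@le_trans _ _ ((9 * A ^+ 2)%:E + ((8 * c k ^+ 2)%:E * A%:E + (9 * c k ^+ 4)%:E))%E).
  by rewrite leeD2r//; exact: IH (ltnW pn).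
rewrite -EFinM -!EFinD lee_fin.
have := mulr_ge0 A0 (sqr_ge0 (c k)); lra.
Qed.

Lemma lower_fourth_moment (U : 'I_n -> 'I_n -> R) (j : 'I_n) :
  (Ex (fun x : F => lower U j x ^+ 4) <= (9 * lowersq U j ^+ 2)%:E)%E.
Proof. exact: (linear_fourth_moment _ (ltnW (ltn_ord j))). Qed.

(** Peeling off coordinate [k] turns [M] into [M + x_k L], where [L] is a linear form in the earlier
    coordinates. The induction closes for any constant of at least 144. *)
Lemma chaos_fourth_moment (U : 'I_n -> 'I_n -> R) (p : nat) : (p <= n)%N ->
  (Ex (fun x : F => (\sum_(j < n | (j < p)%N) x j * lower U j x) ^+ 4)
   <= (225 * (\sum_(j < n | (j < p)%N) lowersq U j) ^+ 2)%:E)%E.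
Proof.
have mL := @measurable_lower R n U; have pL := @predictable_lower R n U.
elim: p => [_|p IH pn].
  by rewrite (@Ex_eq _ (fun=> 0)) ?Ex_cst ?sum_below0 ?expr0n ?mulr0// => x; rewrite sum_below0 expr0n.
pose k := Ordinal pn; rewrite (sum_below_recr k).
set A := \sum_(j < n | (j < k)%N) lowersq U j; set q := lowersq U k.
have A0 : 0 <= A by apply: sumr_ge0 => j _; exact: lowersq_ge0.
have q0 : 0 <= q by exact: lowersq_ge0.
pose M (x : F) := \sum_(j < n | (j < k)%N) x j * lower U j x.
have mM : measurable_fun setT M by rewrite /M; meas_tac.
have IHk : (Ex (fun x => M x ^+ 4) <= (225 * A ^+ 2)%:E)%E by exact: IH (ltnW pn).
have Hq : (Ex (fun x => lower U k x ^+ 4) <= (9 * q ^+ 2)%:E)%E by exact: lower_fourth_moment.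
have E x : (\int[nu]_t ((\sum_(j < n | (j < p.+1)%N) (upd k t x) j * lower U j (upd k t x)) ^+ 4)%:E
    <= (M x ^+ 4 + 8 * (M x ^+ 2 * lower U k x ^+ 2) + 9 * lower U k x ^+ 4)%:E)%E.
  under eq_integral => t _.
    rewrite (sum_below_recr k) (sum_below_upd (fun _ a b => a * b) k t x pL).
    rewrite upd_same pL// -/(M x) [t * _]mulrC.
    over.
  exact: integral_affine_pow4.
(* [M] and [L] are dependent, so the cross term [8 M^2 L^2] is split as [4 al M^4 + (4 / al) L^4],
   the weight being chosen once the expectations are known. *)
have gen (al : R) : 0 < al -> (Ex (fun x : F => (\sum_(j < n | (j < p.+1)%N) x j * lower U j x) ^+ 4)
    <= ((1 + 4 * al) * (225 * A ^+ 2) + (9 + 4 / al) * (9 * q ^+ 2))%:E)%E.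
  move=> al0.
  have c1 : 0 <= 1 + 4 * al by rewrite addr_ge0// mulr_ge0// ltW.
  have c2 : 0 <= 9 + 4 / al by rewrite addr_ge0// divr_ge0// ltW.
  apply: (@le_trans _ _ (Ex (fun x => (1 + 4 * al) * M x ^+ 4 + (9 + 4 / al) * lower U k x ^+ 4))).
    apply: (step_le (k := k)); [by meas_tac|by meas_tac|by move=> x; exact: exprn_even_ge0|move=> x].
    apply: (le_trans (E x)); rewrite lee_fin.
    have h : 0 <= 4 / al * (al * M x ^+ 2 - lower U k x ^+ 2) ^+ 2.
      by rewrite mulr_ge0 ?sqr_ge0// divr_ge0// ltW.
    have e : 4 / al * (al * M x ^+ 2 - lower U k x ^+ 2) ^+ 2 =
        4 * al * M x ^+ 4 - 8 * (M x ^+ 2 * lower U k x ^+ 2) + 4 / al * lower U k x ^+ 4.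
      by field; rewrite gt_eqF.
    by rewrite e in h; lra.
  have i4 (y : R) : 0 <= y ^+ 4 by exact: exprn_even_ge0.
  rewrite ExD; [|by meas_tac|by meas_tac|by move=> x; rewrite mulr_ge0|by move=> x; rewrite mulr_ge0].
  rewrite !ExZ//; try by meas_tac.
  apply: (@le_trans _ _ ((1 + 4 * al)%:E * (225 * A ^+ 2)%:E + (9 + 4 / al)%:E * (9 * q ^+ 2)%:E)%E).
    by apply: leeD; apply: lee_wpmul2l; rewrite ?lee_fin.
  by rewrite -!EFinM -EFinD.
have [qz|qn] := eqVneq q 0.
  have L0 x : lower U k x = 0.
    apply: big1 => j jk; have /psumr_eq0P : q = 0 by [].
    by move=> /(_ (fun j _ => sqr_ge0 _) j jk) /eqP; rewrite sqrf_eq0 => /eqP ->; rewrite mul0r.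
  rewrite qz addr0; apply: le_trans IHk.
  apply: (step_le (k := k)); [by meas_tac|by meas_tac|by move=> x; exact: exprn_even_ge0|move=> x].
  by apply: (le_trans (E x)); rewrite L0 lee_fin; lra.
have qp : 0 < q by rewrite lt_neqAle eq_sym qn.
have [Az|An] := eqVneq A 0.
  apply: (le_trans (gen 1 ltr01)); rewrite Az lee_fin.
  have := sqr_ge0 q; lra.
have Ap : 0 < A by rewrite lt_neqAle eq_sym An.
(* This weight makes both halves of the cross term multiples of [A q], namely [225 A q] and
   [144 A q], which fit into the [450 A q] of the expanded square. *)
apply: (le_trans (gen (q / (4 * A)) _)); first by rewrite divr_gt0// mulr_gt0.
rewrite lee_fin.
have -> : (1 + 4 * (q / (4 * A))) * (225 * A ^+ 2) = 225 * A ^+ 2 + 225 * (A * q).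
  by field; rewrite gt_eqF.
have -> : (9 + 4 / (q / (4 * A))) * (9 * q ^+ 2) = 81 * q ^+ 2 + 144 * (A * q).
  by field; rewrite !gt_eqF.
have := sqr_ge0 q; have := mulr_ge0 A0 q0; lra.
Qed.

(** Integrating out coordinate [k] leaves [(b + h + Z)^2] plus [(2 L)^2 + 4 h m3 L + h^2 (m4 - 1)],
    and [skewness_le] bounds the latter below by the square [(2 L + h m3)^2], whose mean is at least
    [4 lowersq]. The offset [b] collects the means [h] of the removed diagonal terms. *)
Lemma chaos_second_moment (U : 'I_n -> 'I_n -> R) (h b : R) (p : nat) : (p <= n)%N ->
  (((b + p%:R * h) ^+ 2 + 4 * \sum_(j < n | (j < p)%N) lowersq U j)%:E <=
  Ex (fun x : F => (b + \sum_(j < n | (j < p)%N) (h * x j ^+ 2 + 2 * (x j * lower U j x))) ^+ 2))%E.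
Proof.
have mL := @measurable_lower R n U; have pL := @predictable_lower R n U.
elim: p b => [b _|p IH b pn].
  rewrite (@Ex_eq _ (fun=> b ^+ 2)); last by move=> x; rewrite sum_below0 addr0.
  by rewrite Ex_cst sum_below0 mulr0 mul0r !addr0.
pose k := Ordinal pn; rewrite (sum_below_recr k).
pose Z (x : F) := \sum_(j < n | (j < k)%N) (h * x j ^+ 2 + 2 * (x j * lower U j x)).
have mZ : measurable_fun setT Z by rewrite /Z; meas_tac.
have mk := mL k.
set m3 := moment nu 3.
apply: (@le_trans _ _ (Ex (fun x => (b + h + Z x) ^+ 2 + (h * m3 + 2 * lower U k x) ^+ 2))); last first.
  apply: (step_ge (k := k)); [by meas_tac|by meas_tac|by move=> x; exact: sqr_ge0
    |by move=> x; rewrite addr_ge0 ?sqr_ge0|move=> x].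
  under eq_integral => t _.
    rewrite (sum_below_recr k) (sum_below_upd (fun _ a b => h * a ^+ 2 + 2 * (a * b)) k t x pL).
    rewrite upd_same pL// -/(Z x) (_ : b + (Z x + (h * t ^+ 2 + 2 * (t * lower U k x))) =
      (b + Z x) + (2 * lower U k x) * t + h * t ^+ 2); last by ring.
    over.
  rewrite integral_quadratic_sqr// lee_fin -/m3.
  have := skewness_le subg mean0 var1; rewrite -/m3 => s.
  have := mulr_ge0 (sqr_ge0 h) (_ : 0 <= moment nu 4 - 1 - m3 ^+ 2).
  by move=> /(_ _)/wrap[]; [lra|]; lra.
rewrite ExD; [|by meas_tac|by meas_tac|by move=> x; exact: sqr_ge0|by move=> x; exact: sqr_ge0].
have -> : (Ex (fun x : F => (h * m3 + 2 * lower U k x) ^+ 2) = ((h * m3) ^+ 2 + 4 * lowersq U k)%:E)%E.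
  have := linear_second_moment (h * m3) (fun i => 2 * U k i) (ltnW (ltn_ord k)).
  have -> : \sum_(j < n | (j < k)%N) (2 * U k j) ^+ 2 = 4 * lowersq U k.
    by rewrite mulr_sumr; apply: eq_bigr => j _; ring.
  move=> <-; apply: Ex_eq => x; congr ((_ + _) ^+ 2).
  by rewrite mulr_sumr; apply: eq_bigr => j _; ring.
apply: le_trans (leeD (IH (b + h) (ltnW pn)) (lexx _)).
rewrite -EFinD lee_fin -[p.+1%:R]natr1.
have := sqr_ge0 (h * m3).
have -> : b + (p%:R + 1) * h = b + h + p%:R * h by ring.
move: (\sum_(j < n | _) _) (lowersq U k) ((b + h + p%:R * h) ^+ 2) => a1 a2 a3; lra.
Qed.

End Processes.

(** * Simultaneous control of the quadratic forms of all atoms *)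

Section Control.
Context {R : realType}.

Lemma term_le_sum (I : finType) (F : I -> R) i : (forall j, 0 <= F j) -> F i <= \sum_j F j.
Proof. by move=> F0; rewrite (bigD1 i)//= lerDl sumr_ge0. Qed.

Lemma lowersq_atom_le n l (j : 'I_n) : lowersq (atom n l : 'M[R]_n) j <= rowsq n j.
Proof.
apply: le_trans (atom_row_le l j).
rewrite /lowersq big_mkcond /=; apply: ler_sum => k _; case: ifP => // _; exact: sqr_ge0.
Qed.

(** Row [j] of the strictly lower part of a signed atom, scaled to norm at most one. Both signs
    occur, so that exponential bounds become two-sided. *)
Definition row_coef n (l : nat) (b : bool) (j k : 'I_n) : R :=
  if (k < j)%N then (-1) ^+ b * (atom n l j k / Num.sqrt (rowsq n j)) else 0.

(* A sum of nonnegative functions with small expectation: if it is below 1, then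
   every summand is, and the summands control [x^T W_l x] for all atoms at once. *)
Definition ctrl n (C K1 s : R) (x : fspace R 'I_n) : R :=
  (K1 * n%:R)^-1 * (\sum_(j < n) x j ^+ 2) +
  expR (- s) * (\sum_(l < 2 * n) \sum_(b : bool)
      expR (\sum_j (x j * ((-1) ^+ b * lower (atom n l) j x) -
        C * ((-1) ^+ b * lower (atom n l) j x) ^+ 2)) +
    \sum_(l < 2 * n) \sum_(b : bool) \sum_(j < n)
      expR (\sum_k row_coef l b j k * x k - C * \sum_k row_coef l b j k ^+ 2)).

Lemma measurable_ctrl n C K1 s : measurable_fun setT (@ctrl n C K1 s).
Proof.
have mL l j := @measurable_lower R n (atom n l) j.
by rewrite /ctrl; meas_tac.
Qed.

Lemma ctrl_ge0 n C K1 s x : 0 < K1 -> 0 <= @ctrl n C K1 s x.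
Proof.
move=> K0; rewrite /ctrl; apply: addr_ge0.
  by rewrite mulr_ge0 ?invr_ge0 ?mulr_ge0 ?(ltW K0)// sumr_ge0// => j _; exact: sqr_ge0.
rewrite mulr_ge0 ?expR_ge0// addr_ge0//; apply: sumr_ge0 => l _; apply: sumr_ge0 => b _.
  exact: expR_ge0.
by apply: sumr_ge0 => j _; exact: expR_ge0.
Qed.

(** Each exponential has expectation at most one, and there are [4 n + 4 n^2 <= 8 n^2] of them. *)
Lemma Expect_ctrl_le (nu : probability R R) (d : measure_display) (T : measurableType d)
    (P : probability T R) n (X : 'I_n -> T -> R) (C K1 s : R) :
  iid_family nu P X -> (0 < n)%N -> 0 < K1 ->
  (\int[nu]_x ((x ^+ 2)%:E) = 1)%E ->
  (forall t : R, (\int[nu]_x (expR (t * x))%:E <= (expR (C * t ^+ 2))%:E)%E) ->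
  (Expect P X (@ctrl n C K1 s) <= (K1^-1 + expR (- s) * (8 * n%:R ^+ 2))%:E)%E.
Proof.
move=> iidX n0 K0 var1 mgf.
have nR : 0 < n%:R :> R by rewrite ltr0n.
have mL l j := @measurable_lower R n (atom n l) j.
have pL l := @predictable_lower R n (atom n l).
pose f2 l b (x : fspace R 'I_n) := expR (\sum_j (x j * ((-1) ^+ (b : bool) * lower (atom n l) j x) -
        C * ((-1) ^+ b * lower (atom n l) j x) ^+ 2)).
pose f3 l b j (x : fspace R 'I_n) := expR (\sum_k row_coef l b j k * x k - C * \sum_k row_coef l b j k ^+ 2).
have m2 l b : measurable_fun setT (f2 l b) by rewrite /f2; meas_tac.
have m3 l b j : measurable_fun setT (f3 l b j) by rewrite /f3; meas_tac.
have e2 l b : (Expect P X (f2 l b) <= 1)%E.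
  apply: (exp_supermartingale iidX (v := fun j x => (-1) ^+ (b : bool) * lower (atom n l) j x) mgf).
    by move=> j; meas_tac.
  by move=> j k t x jk; rewrite pL.
have e3 l b j : (Expect P X (f3 l b j) <= 1)%E by exact: (exp_linear_le1 iidX _ mgf).
have p2 l b x : 0 <= f2 l b x by exact: expR_ge0.
have p3 l b j x : 0 <= f3 l b j x by exact: expR_ge0.
have cE : @ctrl n C K1 s = (fun x => (K1 * n%:R)^-1 * (\sum_(j < n) x j ^+ 2) +
  expR (- s) * (\sum_(l < 2 * n) \sum_(b : bool) f2 l b x +
    \sum_(l < 2 * n) \sum_(b : bool) \sum_(j < n) f3 l b j x)) by [].
clearbody f2 f3.
have k0 : 0 <= (K1 * n%:R)^-1 by rewrite invr_ge0 mulr_ge0// ltW.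
have q0 x : 0 <= \sum_(j < n) (x : fspace R 'I_n) j ^+ 2 by apply: sumr_ge0 => j _; exact: sqr_ge0.
have s2 x : 0 <= \sum_(l < 2 * n) \sum_(b : bool) f2 l b x.
  by apply: sumr_ge0 => l _; apply: sumr_ge0.
have s3 x : 0 <= \sum_(l < 2 * n) \sum_(b : bool) \sum_(j < n) f3 l b j x.
  by apply: sumr_ge0 => l _; apply: sumr_ge0 => b _; apply: sumr_ge0.
have E1 : (Expect P X (fun x => \sum_(j < n) x j ^+ 2)%R = (n%:R)%:E)%E.
  rewrite (Ex_sum iidX); [|by move=> i; meas_tac|by move=> i x; exact: sqr_ge0].
  transitivity (\sum_(j < n) (1%:E : \bar R))%E.
    apply: eq_bigr => j _; rewrite -var1.
    apply: (integral_coord iidX j (g := fun t => (t ^+ 2)%:E)).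
      by apply/measurable_EFinP; meas_tac.
    by move=> t; rewrite lee_fin sqr_ge0.
  by rewrite sumEFin sumr_const card_ord.
have E2 : (Expect P X (fun x => \sum_(l < 2 * n) \sum_(b : bool) f2 l b x)%R <= (4 * n%:R)%:E)%E.
  rewrite (Ex_sum iidX); [|by move=> i; meas_tac|by move=> i x; apply: sumr_ge0].
  apply: (@le_trans _ _ (\sum_(l < 2 * n) ((2 : R)%:E))%E).
    apply: lee_sum => l _; rewrite (Ex_sum iidX)// big_bool /=.
    have -> : (2 : R)%:E = (1 + 1)%E by rewrite -EFinD.
    exact: leeD.
  rewrite sumEFin sumr_const card_ord lee_fin -[_ *+ (2 * n)]mulr_natl natrM; lra.
have E3 : (Expect P X (fun x => \sum_(l < 2 * n) \sum_(b : bool) \sum_(j < n) f3 l b j x)%R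
    <= (4 * n%:R ^+ 2)%:E)%E.
  rewrite (Ex_sum iidX); [|by move=> i; meas_tac|by move=> i x; apply: sumr_ge0 => b _; apply: sumr_ge0].
  apply: (@le_trans _ _ (\sum_(l < 2 * n) ((n%:R + n%:R : R)%:E))%E).
    have h l b : (Expect P X (fun x => \sum_(j < n) f3 l b j x)%R <= (n%:R)%:E)%E.
      rewrite (Ex_sum iidX)//; apply: (@le_trans _ _ (\sum_(j < n) (1%:E : \bar R))%E).
        by apply: lee_sum => j _.
      by rewrite sumEFin sumr_const card_ord.
    apply: lee_sum => l _; rewrite (Ex_sum iidX); [|by move=> b; meas_tac|by move=> b x; apply: sumr_ge0].
    by rewrite big_bool /= EFinD; apply: leeD.
  rewrite sumEFin sumr_const card_ord lee_fin -[_ *+ (2 * n)]mulr_natl natrM; lra.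
rewrite cE (@ExD _ _ _ _ _ _ _ iidX); [|by meas_tac|by meas_tac|by move=> x; rewrite mulr_ge0
  |by move=> x; rewrite mulr_ge0 ?expR_ge0// addr_ge0].
have Z1 := ExZ iidX (f := fun x => \sum_(j < n) x j ^+ 2) (c := (K1 * n%:R)^-1).
rewrite Z1; [|by meas_tac|exact: q0|exact: k0].
have Z2 := ExZ iidX (f := fun x => \sum_(l < 2 * n) \sum_(b : bool) f2 l b x +
    \sum_(l < 2 * n) \sum_(b : bool) \sum_(j < n) f3 l b j x) (c := expR (- s)).
rewrite Z2; [|by meas_tac|by move=> x; rewrite addr_ge0|exact: expR_ge0].
rewrite (@ExD _ _ _ _ _ _ _ iidX); [|by meas_tac|by meas_tac|exact: s2|exact: s3].
rewrite E1 EFinD; apply: leeD.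
  by rewrite -EFinM lee_fin invfM -mulrA mulVf ?mulr1// gt_eqF.
rewrite EFinM; apply: lee_wpmul2l; first by rewrite lee_fin expR_ge0.
apply: (le_trans (leeD E2 E3)); rewrite -EFinD lee_fin.
have : n%:R <= n%:R ^+ 2 :> R by rewrite -natrX ler_nat expnS leq_pmulr// expn1.
lra.
Qed.

(** The compensator of the off-diagonal chaos is itself random. The row terms of [ctrl] bound every
    partial linear form, hence the compensator; only then do the supermartingale terms bound the
    chaos. The diagonal [1/n] leaves the normalized sum of squares, at most [K1]. *)
Lemma ctrl_lt1 n (C K1 s : R) x l : (0 < n)%N -> 0 < K1 -> 0 <= C -> 0 <= s ->
  (l < 2 * n)%N -> @ctrl n C K1 s x < 1 ->
  `|qform (atom n l) x| <= K1 + 2 * (s + C * ((s + C) ^+ 2 * (2 * (1 + ln n%:R)))).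
Proof.
move=> n0 K0 C0 s0 ln2 cx.
have nR : 0 < n%:R :> R by rewrite ltr0n.
have es : 0 < expR (- s) by exact: expR_gt0.
pose S1 := (K1 * n%:R)^-1 * (\sum_(j < n) x j ^+ 2).
pose f2 (l : 'I_(2 * n)) b := expR (\sum_j (x j * ((-1) ^+ (b : bool) * lower (atom n l) j x) -
        C * ((-1) ^+ b * lower (atom n l) j x) ^+ 2)).
pose f3 (l : 'I_(2 * n)) b j := expR (\sum_k row_coef l b j k * x k - C * \sum_k row_coef l b j k ^+ 2).
pose S2 := \sum_l \sum_b f2 l b; pose S3 := \sum_l \sum_b \sum_j f3 l b j.
have p2 l' b : 0 <= f2 l' b by exact: expR_ge0.
have p3 l' b j : 0 <= f3 l' b j by exact: expR_ge0.
have cE : ctrl C K1 s x = S1 + expR (- s) * (S2 + S3) by [].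
have S10 : 0 <= S1.
  by rewrite mulr_ge0 ?invr_ge0 ?mulr_ge0 ?(ltW K0)// sumr_ge0// => j _; exact: sqr_ge0.
have S20 : 0 <= S2 by apply: sumr_ge0 => l' _; apply: sumr_ge0.
have S30 : 0 <= S3 by apply: sumr_ge0 => l' _; apply: sumr_ge0 => b _; apply: sumr_ge0.
have e20 : 0 <= expR (- s) * S2 by rewrite mulr_ge0// ltW.
have e30 : 0 <= expR (- s) * S3 by rewrite mulr_ge0// ltW.
rewrite cE mulrDr in cx.
pose l' : 'I_(2 * n) := Ordinal ln2.
have small (y : R) : expR (- s) * expR y < 1 -> y <= s.
  by rewrite -expRD expR_lt1 => h; lra.
have b2 b : \sum_j (x j * ((-1) ^+ (b : bool) * lower (atom n l) j x) -
        C * ((-1) ^+ b * lower (atom n l) j x) ^+ 2) <= s.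
  apply: small; apply: (@le_lt_trans _ _ (expR (- s) * S2)); last by lra.
  rewrite ler_pM2l// -[expR _]/(f2 l' b); apply: (le_trans (term_le_sum b (p2 l'))).
  by apply: (term_le_sum l' (F := fun l => \sum_b f2 l b)) => i; apply: sumr_ge0.
have b3 b j : \sum_k row_coef l b j k * x k - C * \sum_k row_coef l b j k ^+ 2 <= s.
  apply: small; apply: (@le_lt_trans _ _ (expR (- s) * S3)); last by lra.
  rewrite ler_pM2l// -[expR _]/(f3 l' b j); apply: (le_trans (term_le_sum j (p3 l' b))).
  apply: (@le_trans _ _ (\sum_b \sum_j f3 l' b j)).
    by apply: (term_le_sum b (F := fun b => \sum_j f3 l' b j)) => i; apply: sumr_ge0.
  by apply: (term_le_sum l' (F := fun l => \sum_b \sum_j f3 l b j)) => i; apply: sumr_ge0 => b' _; apply: sumr_ge0.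
(* The row exponentials below [exp s] give [|v / r| <= s + C], since the scaled coefficients have
   squared norm at most one. *)
have vb j : lower (atom n l) j x ^+ 2 <= (s + C) ^+ 2 * rowsq n j.
  set v := lower _ j x; pose r : R := Num.sqrt (rowsq n j).
  have r2 : 0 < rowsq n j :> R by exact: rowsq_gt0.
  have r0 : 0 < r by rewrite sqrtr_gt0.
  have rr : r ^+ 2 = rowsq n j by rewrite sqr_sqrtr// ltW.
  have c1 b : \sum_k row_coef l b j k * x k = (-1) ^+ b * (v / r).
    rewrite /v /lower mulr_suml mulr_sumr [RHS]big_mkcond /=; apply: eq_bigr => k _.
    by rewrite /row_coef -/r; case: ifP => _; [ring|rewrite mul0r].
  have c2 b : \sum_k row_coef l b j k ^+ 2 <= 1.
    have -> : \sum_k row_coef l b j k ^+ 2 = lowersq (atom n l) j / rowsq n j.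
      rewrite /lowersq mulr_suml [RHS]big_mkcond /=; apply: eq_bigr => k _.
      rewrite /row_coef -/r; case: ifP => _; last by rewrite expr0n.
      by rewrite exprMn sqrr_sign mul1r expr_div_n rr.
    by rewrite ler_pdivrMr// mul1r lowersq_atom_le.
  have vr : `|v / r| <= s + C.
    rewrite ler_norml; apply/andP; split.
      have := b3 true j; rewrite c1 expr1 mulN1r => h.
      have := ler_wpM2l C0 (c2 true); lra.
    have := b3 false j; rewrite c1 expr0 mul1r => h.
    have := ler_wpM2l C0 (c2 false); lra.
  rewrite -rr -ler_pdivrMr ?exprn_gt0// -expr_div_n -real_normK ?num_real//.
  by rewrite lerXn2r ?nnegrE ?addr_ge0.
have Q : \sum_j lower (atom n l) j x ^+ 2 <= (s + C) ^+ 2 * (2 * (1 + ln n%:R)).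
  apply: (@le_trans _ _ (\sum_(j < n) (s + C) ^+ 2 * rowsq n j)); first by apply: ler_sum => j _; exact: vb.
  by rewrite -mulr_sumr ler_wpM2l ?sqr_ge0// sum_rowsq_le.
pose M := \sum_j x j * lower (atom n l) j x.
have bM (b : bool) : (-1) ^+ b * M <= s + C * \sum_j lower (atom n l) j x ^+ 2.
  have := b2 b; rewrite sumrB.
  have -> : \sum_i x i * ((-1) ^+ b * lower (atom n l) i x) = (-1) ^+ b * M.
    by rewrite mulr_sumr; apply: eq_bigr => j _; ring.
  have -> : \sum_(i < n) C * ((-1) ^+ b * lower (atom n l) i x) ^+ 2 = C * \sum_j lower (atom n l) j x ^+ 2.
    by rewrite mulr_sumr; apply: eq_bigr => j _; rewrite exprMn sqrr_sign mul1r.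
  lra.
have nM : `|M| <= s + C * ((s + C) ^+ 2 * (2 * (1 + ln n%:R))).
  apply: (@le_trans _ _ (s + C * \sum_j lower (atom n l) j x ^+ 2)); last by rewrite lerD2l ler_wpM2l.
  rewrite ler_norml; have := bM true; have := bM false; rewrite expr0 expr1 mul1r mulN1r => h1 h2.
  by apply/andP; split; lra.
have Wsym : (atom n l)^T = atom n l :> 'M[R]_n by apply/matrixP => i j; rewrite mxE atom_sym.
rewrite (qform_lower x Wsym (@atom_diag R n l)) big_split /= -!mulr_sumr -/M.
apply: (le_trans (ler_normD _ _)); apply: lerD; last first.
  by rewrite normrM ger0_norm// ler_pM2l.
have q0 : 0 <= \sum_(j < n) x j ^+ 2 by apply: sumr_ge0 => j _; exact: sqr_ge0.
rewrite ger0_norm ?mulr_ge0 ?invr_ge0// ler_pdivrMl//.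
have : S1 < 1 by lra.
by rewrite /S1 ltr_pdivrMl ?mulr_gt0// mulr1 mulrC => /ltW.
Qed.

(** Makes [2 ln n >= 1], which lets constants and lower powers of the logarithm be absorbed into
    higher ones. *)
Lemma ln_ge_half n : (1 < n)%N -> 1 / 2 <= ln n%:R :> R.
Proof.
move=> n1; apply: (@le_trans _ _ (ln 2)); last by rewrite ler_ln ?posrE ?ltr0n ?ler_nat//; lia.
rewrite -ler_expR lnK ?posrE//.
have e : expR (1 / 2) * expR (- (1 / 2)) = 1 :> R by rewrite -expRD subrr expR0.
have h : 1 / 2 <= expR (- (1 / 2)) :> R by have := expR_ge1Dx (- (1 / 2) : R); lra.
have := ler_wpM2l (ltW (expR_gt0 (1 / 2 : R))) h; rewrite e; lra.
Qed.

Lemma control_exists (nu : probability R R) (de : R) :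
  0 < de -> subgaussian nu -> (\int[nu]_x (x%:E) = 0)%E -> (\int[nu]_x ((x ^+ 2)%:E) = 1)%E ->
  exists2 kap : R, 0 < kap & forall n, (1 < n)%N ->
  exists G : set (fspace R 'I_n), [/\ measurable G,
    forall x l, G x -> (l < 2 * n)%N -> `|qform (atom n l) x| <= kap * ln n%:R ^+ 3
  & forall (d : measure_display) (T : measurableType d) (P : probability T R) (X : 'I_n -> T -> R),
      iid_family nu P X -> (Expect P X (\1_(~` G)) <= de%:E)%E].
Proof.
move=> de0 subg mean0 var1; have [C C0 mgf] := mgf_bound subg mean0.
(* Each of the two parts of the expectation of [ctrl] receives half of the budget [de], as
   [1 / K1 <= de / 2]. *)
pose K1 := 2 / de + 1.
have K10 : 0 < 2 / de by rewrite divr_gt0.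
have K1g : 1 <= K1 by rewrite /K1; lra.
have K0 : 0 < K1 by lra.
have K8 : 0 <= ln (8 * K1) by rewrite ln_ge0//; lra.
pose a := 2 * ln (8 * K1) + 2; have a0 : 0 < a by rewrite /a; lra.
exists (8 * K1 + 8 * a + 12 * (C * (a + 2 * C) ^+ 2)).
  have := mulr_ge0 (ltW C0) (sqr_ge0 (a + 2 * C)); lra.
move=> n n1; have n0 : (0 < n)%N by exact: ltnW.
have nR : 0 < n%:R :> R by rewrite ltr0n.
have L2 := ln_ge_half n1; set L := ln n%:R in L2 *.
(* Chosen so that [exp (- s)] times the [8 n^2] exponentials is exactly [1 / K1]; the term [2 L]
   pays for their number. *)
pose s := ln (8 * K1) + 2 * L.
have s0 : 0 <= s by rewrite /s; lra.
have sa : s <= a * L by have := mulr_ge0 K8 (_ : 0 <= 2 * L - 1); rewrite /s /a => /(_ _)/wrap[]; lra.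
pose G : set (fspace R 'I_n) := [set x | ctrl C K1 s x < 1].
have mG : measurable G.
  have mc := @measurable_ctrl n C K1 s.
  have -> : G = (@ctrl n C K1 s) @^-1` [set` `]-oo, 1[].
    by apply/seteqP; split => x /=; rewrite in_itv.
  by rewrite -[X in measurable X]setTI; apply: mc => //; exact: measurable_itv.
exists G; split=> //.
- move=> x l /= cx ln2; apply: (le_trans (ctrl_lt1 n0 K0 (ltW C0) s0 ln2 cx)).
  rewrite -/L.
  have L0 : 0 < L by lra.
  have LL : 1 / 4 <= L ^+ 2 by have := sqr_ge0 (L - 1 / 2); nra.
  have h1 : L <= 4 * L ^+ 3.
    by have := ler_wpM2l (ltW L0) LL; rewrite -exprS; lra.
  have h2 : 1 <= 8 * L ^+ 3 by lra.
  have h3 : (s + C) ^+ 2 <= (a + 2 * C) ^+ 2 * L ^+ 2.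
    rewrite -exprMn lerXn2r ?nnegrE ?addr_ge0 ?mulr_ge0 ?addr_ge0 ?mulr_ge0 ?(ltW C0) ?(ltW a0) ?(ltW L0)//.
    have := mulr_ge0 (ltW C0) (_ : 0 <= 2 * L - 1) => /(_ _)/wrap[]; lra.
  have h4 : (s + C) ^+ 2 * (2 * (1 + L)) <= 6 * ((a + 2 * C) ^+ 2 * L ^+ 3).
    apply: (@le_trans _ _ ((a + 2 * C) ^+ 2 * L ^+ 2 * (6 * L))).
      by apply: ler_pM => //; [exact: sqr_ge0|lra|lra].
    by rewrite le_eqVlt; apply/orP; left; apply/eqP; ring.
  have h5 := ler_wpM2l (ltW C0) h4.
  have h6 : s <= 4 * a * L ^+ 3 by have := ler_wpM2l (ltW a0) h1; lra.
  have h7 := ler_wpM2l (ltW K0) h2.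
  move: h5 h6 h7; move: (s + C) => sC; move: (C * (sC ^+ 2 * _)) => Q h5 h6 h7; lra.
- move=> d T P X iidX.
  apply: (@le_trans _ _ (Expect P X (@ctrl n C K1 s))).
    apply: (Ex_le iidX).
    + by apply: measurable_indic; exact: measurableC.
    + exact: measurable_ctrl.
    + by move=> x.
    (* Markov's inequality in pointwise form: off [G] the function [ctrl] is at least one. *)
    + move=> x; rewrite indicE; case: (boolP (x \in ~` G)) => [|_]; last exact: ctrl_ge0.
      by rewrite inE /G /setC /= => /negP; rewrite -leNgt.
  apply: (le_trans (Expect_ctrl_le s iidX n0 K0 var1 mgf)); rewrite lee_fin.
  have -> : expR (- s) * (8 * n%:R ^+ 2) = K1^-1.
    rewrite expRN /s expRD lnK ?posrE ?mulr_gt0// expRM_natl lnK ?posrE//.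
    by field; rewrite !gt_eqF.
  have : K1^-1 <= de / 2.
    rewrite -[de / 2]invrK lef_pV2 ?posrE ?invr_gt0 ?divr_gt0// invf_div /K1; lra.
  lra.
Qed.

End Control.

(** * Truncated moments and the lower tail of the empirical quadratic form *)

Section Truncation.
Context {R : realType} (nu : probability R R).
Hypothesis subg : subgaussian nu.
Hypothesis mean0 : (\int[nu]_x (x%:E) = 0)%E.
Hypothesis var1 : (\int[nu]_x ((x ^+ 2)%:E) = 1)%E.
Hypothesis mom4 : (\int[nu]_x ((x ^+ 4)%:E) <= 3%:E)%E.

Lemma sum_pow4_le (n : nat) (y : 'I_n -> R) : (\sum_j y j) ^+ 4 <= n%:R ^+ 3 * \sum_j y j ^+ 4.
Proof.
have cs (z : 'I_n -> R) : (\sum_j z j) ^+ 2 <= n%:R * \sum_j z j ^+ 2.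
  have := cauchy_schwarz_sum (fun=> 1) z.
  under [X in X ^+ 2]eq_bigr do rewrite mul1r.
  by under [X in X * _]eq_bigr do rewrite expr1n; rewrite sumr_const card_ord.
have s0 : 0 <= \sum_j y j ^+ 2 by apply: sumr_ge0 => j _; exact: sqr_ge0.
have -> : (\sum_j y j) ^+ 4 = ((\sum_j y j) ^+ 2) ^+ 2 by ring.
apply: (@le_trans _ _ ((n%:R * \sum_j y j ^+ 2) ^+ 2)).
  by rewrite lerXn2r ?nnegrE ?sqr_ge0 ?mulr_ge0.
have e3 : n%:R ^+ 3 = n%:R ^+ 2 * n%:R :> R by rewrite exprSr.
rewrite exprMn e3 -mulrA ler_wpM2l ?sqr_ge0//.
apply: (le_trans (cs _)); rewrite ler_wpM2l//.
by apply: ler_sum => j _; rewrite -exprM.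
Qed.

(** From [(u + v)^4 <= 8 u^4 + 8 v^4]: the diagonal part gives [8 m8 (n^2 h^2)^2], and the doubled
    chaos gives [8 * 16 * 225 A^2], where [16 A^2 <= V^2]. *)
Definition C4 : R := 8 * (moment nu 8 + 225).

Lemma moment8_ge0 : 0 <= moment nu 8.
Proof. by apply: fine_ge0; apply: int_ge0 => x; exact: exprn_even_ge0. Qed.

Lemma C4_ge1 : 1 <= C4.
Proof. by rewrite /C4; have := moment8_ge0; lra. Qed.

Lemma inv_mul4_ge0 (c w : R) : 0 < c -> 0 < w -> 0 <= (4 * c * w)^-1.
Proof. by move=> c0 w0; rewrite invr_ge0 ltW// !mulr_gt0. Qed.

Section OneRow.
Context (d : measure_display) (T : measurableType d) (P : probability T R).
Context (n : nat) (X : 'I_n -> T -> R).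
Hypothesis iidX : iid_family nu P X.
Variables (U : 'M[R]_n) (h : R).
Hypothesis Usym : U^T = U.
Hypothesis Udiag : forall j, U j j = h.
Local Notation V := (n%:R ^+ 2 * h ^+ 2 + 4 * \sum_j lowersq U j).
Local Notation F := (fspace R 'I_n).
Local Notation Ex f := (Expect P X f%R).

Lemma measurable_qform : measurable_fun setT (qform U : F -> R).
Proof. by rewrite /qform; meas_tac. Qed.

Lemma qform_second_moment : (V%:E <= Ex (fun x => qform U x ^+ 2))%E.
Proof.
have := chaos_second_moment iidX subg mean0 var1 U h 0 (leqnn n).
rewrite add0r exprMn sum_below_all => H; apply: (le_trans H).
rewrite le_eqVlt; apply/orP; left; apply/eqP; apply: Ex_eq => x.
by rewrite add0r sum_below_all (qform_lower x Usym Udiag).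
Qed.

Lemma sum_sqr_fourth_moment :
  (Ex (fun x => (\sum_j x j ^+ 2) ^+ 4) <= (n%:R ^+ 4 * moment nu 8)%:E)%E.
Proof.
apply: (@le_trans _ _ (Ex (fun x => n%:R ^+ 3 * \sum_j (x j ^+ 2) ^+ 4))).
  apply: (Ex_le iidX); [by meas_tac|by meas_tac|by move=> x; exact: exprn_even_ge0|].
  by move=> x; exact: sum_pow4_le.
have p (y : R) : 0 <= (y ^+ 2) ^+ 4 by exact: exprn_even_ge0.
rewrite (ExZ iidX); [|by meas_tac|by move=> x; apply: sumr_ge0|exact: exprn_ge0].
rewrite (Ex_sum iidX); [|by move=> j; meas_tac|by []].
rewrite (eq_bigr (fun=> (moment nu 8)%:E)); last first.
  move=> j _; rewrite -(momentE subg)//.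
  transitivity (\int[nu]_t ((t ^+ 2) ^+ 4)%:E)%E.
    apply: (integral_coord iidX j (g := fun t => ((t ^+ 2) ^+ 4)%:E)).
      by apply/measurable_EFinP; meas_tac.
    by move=> t; rewrite lee_fin.
  by apply: eq_integral => t _; rewrite -exprM.
rewrite sumEFin sumr_const card_ord -EFinM lee_fin -[moment nu 8 *+ n]mulr_natl.
by rewrite mulrA -exprSr.
Qed.

Lemma qform_fourth_moment : (Ex (fun x => qform U x ^+ 4) <= (C4 * V ^+ 2)%:E)%E.
Proof.
have mL := @measurable_lower R n U.
set A := \sum_j lowersq U j.
have A0 : 0 <= A by apply: sumr_ge0 => j _; exact: lowersq_ge0.
pose M (x : F) := \sum_j x j * lower U j x.
have mM : measurable_fun setT M by rewrite /M; meas_tac.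
have i4 (y : R) : 0 <= y ^+ 4 by exact: exprn_even_ge0.
have h40 : 0 <= 8 * h ^+ 4 by rewrite mulr_ge0.
have HM : (Ex (fun x => M x ^+ 4) <= (225 * A ^+ 2)%:E)%E.
  have H := chaos_fourth_moment iidX subg mean0 var1 mom4 U (leqnn n).
  rewrite sum_below_all in H; apply: le_trans H.
  rewrite le_eqVlt; apply/orP; left; apply/eqP; apply: Ex_eq => x.
  by rewrite sum_below_all.
apply: (@le_trans _ _ (Ex (fun x => 8 * h ^+ 4 * (\sum_j x j ^+ 2) ^+ 4 + 128 * M x ^+ 4))).
  apply: (Ex_le iidX); [by have := measurable_qform => mq; meas_tac|by meas_tac|by []|move=> x].
  rewrite (qform_lower x Usym Udiag) big_split /= -!mulr_sumr -/(M x).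
  move: (\sum_j x j ^+ 2) (M x) => a b.
  have e : 8 * h ^+ 4 * a ^+ 4 + 128 * b ^+ 4 - (h * a + 2 * b) ^+ 4 =
    (h * a - 2 * b) ^+ 2 * (2 * ((h * a) ^+ 2 + (2 * b) ^+ 2) + 5 * (h * a + 2 * b) ^+ 2) by ring.
  rewrite -subr_ge0 e mulr_ge0 ?sqr_ge0// addr_ge0// mulr_ge0 ?sqr_ge0// addr_ge0 ?sqr_ge0//.
rewrite (ExD iidX); [|by meas_tac|by meas_tac|by move=> x; rewrite mulr_ge0|by move=> x; rewrite mulr_ge0].
rewrite (ExZ iidX); [|by meas_tac|by []|by []].
rewrite (ExZ iidX); [|by meas_tac|by []|by []].
apply: (@le_trans _ _ ((8 * h ^+ 4)%:E * (n%:R ^+ 4 * moment nu 8)%:E + 128%:E * (225 * A ^+ 2)%:E)%E).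
  apply: leeD; apply: lee_wpmul2l; rewrite ?lee_fin//; exact: sum_sqr_fourth_moment.
rewrite -!EFinM -EFinD lee_fin /C4.
set B := n%:R ^+ 2 * h ^+ 2.
have B0 : 0 <= B by rewrite mulr_ge0 ?sqr_ge0.
have -> : 8 * h ^+ 4 * (n%:R ^+ 4 * moment nu 8) = 8 * (moment nu 8 * B ^+ 2) by rewrite /B; ring.
have m8 := moment8_ge0.
have h1 := mulr_ge0 B0 A0; have h2 := sqr_ge0 A; have h3 := sqr_ge0 B.
have k1 := mulr_ge0 m8 h1; have k2 := mulr_ge0 m8 h2.
move: k1 k2; move: (moment nu 8) m8 => m m8 k1 k2; lra.
Qed.

Variable G : set F.
Hypothesis mG : measurable G.
Hypothesis probG : (Ex (\1_(~` G)) <= ((4 * C4)^-1)%:E)%E.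
Hypothesis V0 : 0 < V.

Definition trunc_sqr (x : F) : R := qform U x ^+ 2 * \1_G x.

Lemma trunc_sqr_ge0 x : 0 <= trunc_sqr x.
Proof. by rewrite mulr_ge0 ?sqr_ge0. Qed.

Lemma measurable_trunc_sqr : measurable_fun setT trunc_sqr.
Proof.
have mq := measurable_qform; have mi : measurable_fun setT (\1_G : F -> R) by exact: measurable_indic.
by rewrite /trunc_sqr; meas_tac.
Qed.

(** Off [G] the square is at most [q^4 / (4 C4 W) + C4 W]. The fourth moment and the tolerance
    [1 / (4 C4)] for the complement turn each summand into [W / 4], so truncation loses at most half
    of the mean. *)
Lemma trunc_sqr_mean : ((V / 2)%:E <= Ex trunc_sqr)%E.
Proof.
have mq := measurable_qform; have mt := measurable_trunc_sqr.
have C1 := C4_ge1; have C0 : 0 < C4 by lra.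
have mi : measurable_fun setT (\1_(~` G) : F -> R) by apply: measurable_indic; exact: measurableC.
have i4 (y : R) : 0 <= y ^+ 4 by exact: exprn_even_ge0.
have q2 := qform_second_moment; have q4 := qform_fourth_moment.
move: V V0 q2 q4 => W W0 q2 q4.
have w0 : 0 <= (4 * C4 * W)^-1 by exact: inv_mul4_ge0.
have w1 : 0 <= C4 * W by exact: ltW (mulr_gt0 C0 W0).
have H : (W%:E <= Ex trunc_sqr + (W / 2)%:E)%E.
  apply: (le_trans q2).
  apply: (@le_trans _ _ (Ex (fun x => trunc_sqr x +
      ((4 * C4 * W)^-1 * qform U x ^+ 4 + C4 * W * \1_(~` G) x)))).
    apply: (Ex_le iidX); [by meas_tac|by meas_tac|by move=> x; exact: sqr_ge0|move=> x].
    rewrite /trunc_sqr !indicE in_setC; case: (x \in G) => /=.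
      by rewrite mulr1 mulr0 addr0 lerDl mulr_ge0.
    rewrite mulr0 add0r mulr1 -subr_ge0.
    have -> : (4 * C4 * W)^-1 * qform U x ^+ 4 + C4 * W - qform U x ^+ 2 =
        (4 * C4 * W)^-1 * (qform U x ^+ 2 - 2 * C4 * W) ^+ 2.
      by field; rewrite !gt_eqF.
    by rewrite mulr_ge0 ?sqr_ge0.
  rewrite (ExD iidX); [|by meas_tac|by meas_tac|exact: trunc_sqr_ge0|by move=> x; apply: addr_ge0; exact: mulr_ge0].
  rewrite (ExD iidX); [|by meas_tac|by meas_tac|by move=> x; rewrite mulr_ge0|by move=> x; rewrite mulr_ge0].
  rewrite (ExZ iidX); [|by meas_tac|by []|by []].
  rewrite (ExZ iidX); [|by meas_tac|by []|by []].
  apply: leeD => //.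
  apply: (@le_trans _ _ ((4 * C4 * W)^-1%:E * (C4 * W ^+ 2)%:E + (C4 * W)%:E * ((4 * C4)^-1)%:E)%E).
    apply: leeD; apply: lee_wpmul2l; rewrite ?lee_fin//.
  rewrite -!EFinM -EFinD lee_fin le_eqVlt; apply/orP; left; apply/eqP.
  by field; rewrite !gt_eqF.
rewrite -leeBlDr// -EFinB in H; apply: le_trans H; rewrite lee_fin; lra.
Qed.

Lemma expN_le (y : R) : 0 <= y -> expR (- y) <= 1 - y + y ^+ 2.
Proof.
move=> y0; have y1 : 0 < 1 + y by lra.
have : expR (- y) * (1 + y) <= 1.
  have e : expR (- y) * expR y = 1 by rewrite -expRD addNr expR0.
  by rewrite -[leRHS]e ler_pM2l ?expR_gt0// expR_ge1Dx.
have : 0 <= y ^+ 3 by exact: exprn_ge0.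
move=> h1 h2; rewrite -(ler_pM2r y1); lra.
Qed.

(** From [exp (- y) <= 1 - y + y^2] for [y >= 0]: at this rate the linear term gains [1 / (8 C4)]
    and the quadratic one costs [1 / (16 C4)]. Nonnegativity is what lets a fourth moment
    suffice. *)
Lemma trunc_sqr_mgf :
  (Ex (fun x => expR (- ((4 * C4 * V)^-1 * trunc_sqr x))) <= (expR (- (16 * C4)^-1))%:E)%E.
Proof.
have mq := measurable_qform; have mt := measurable_trunc_sqr; have t0 := trunc_sqr_ge0.
have C1 := C4_ge1; have C0 : 0 < C4 by lra.
have i4 (y : R) : 0 <= y ^+ 4 by exact: exprn_even_ge0.
have mean := trunc_sqr_mean; have four := qform_fourth_moment.
move: V V0 mean four => W W0 mean four.
set t := (4 * C4 * W)^-1.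
have tp : 0 <= t by exact: inv_mul4_ge0.
have H : (Ex (fun x => expR (- (t * trunc_sqr x))) + (t * (W / 2))%:E <= (1 + t ^+ 2 * (C4 * W ^+ 2))%:E)%E.
  apply: (@le_trans _ _ (Ex (fun x => expR (- (t * trunc_sqr x)) + t * trunc_sqr x))).
    rewrite (ExD iidX); [|by meas_tac|by meas_tac|by move=> x; exact: expR_ge0|by move=> x; rewrite mulr_ge0].
    rewrite (ExZ iidX) // EFinM; apply: leeD => //; exact: lee_wpmul2l.
  apply: (@le_trans _ _ (Ex (fun x => 1 + t ^+ 2 * qform U x ^+ 4))).
    apply: (Ex_le iidX); [by meas_tac|by meas_tac|by move=> x; apply: addr_ge0; [exact: expR_ge0|exact: mulr_ge0]|move=> x].
    have := expN_le (mulr_ge0 tp (t0 x)).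
    have : (t * trunc_sqr x) ^+ 2 <= t ^+ 2 * qform U x ^+ 4.
      rewrite exprMn ler_wpM2l ?sqr_ge0// /trunc_sqr indicE; case: (x \in G) => /=.
        by rewrite mulr1 -exprM.
      by rewrite mulr0 expr0n.
    lra.
  rewrite (ExD iidX); [|by meas_tac|by meas_tac|by []|by move=> x; rewrite mulr_ge0 ?sqr_ge0].
  rewrite (ExZ iidX); [|by meas_tac|by []|exact: sqr_ge0].
  rewrite Ex_cst [leRHS]EFinD; apply: leeD => //; rewrite [leRHS]EFinM.
  by apply: lee_wpmul2l => //; rewrite lee_fin sqr_ge0.
rewrite -leeBrDr// -EFinB in H; apply: (le_trans H); rewrite lee_fin.
apply: le_trans (expR_ge1Dx _); rewrite le_eqVlt; apply/orP; left; apply/eqP.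
by rewrite /t; field; rewrite !gt_eqF.
Qed.

End OneRow.

(** * Independence across the sensing vectors *)

Section Rows.
Context (d : measure_display) (T : measurableType d) (P : probability T R).
Context (m n : nat) (X : 'I_m * 'I_n -> T -> R).
Hypothesis iidX : iid_family nu P X.
Local Notation F := (fspace R ('I_m * 'I_n)%type).

Definition rowX (i : 'I_m) : 'I_n -> T -> R := fun j => X (i, j).

Lemma iid_rowX i : iid_family nu P (rowX i).
Proof. by apply: (iid_family_sub (h := fun j => (i, j))) iidX => j k []. Qed.

Definition rowof (i : 'I_m) (x : F) : fspace R 'I_n := fun j => x (i, j).

Lemma measurable_rowof i : measurable_fun setT (rowof i).
Proof. by apply: measurable_to_fspace => j; exact: measurable_coord. Qed.

Lemma prod_below_recr (k : 'I_m) (f : 'I_m -> R) :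
  \prod_(i < m | (i < k.+1)%N) f i = (\prod_(i < m | (i < k)%N) f i) * f k.
Proof.
rewrite (bigD1 k) /= ?ltnS// mulrC; congr (_ * _); apply: eq_bigl => j.
by rewrite -val_eqE /=; lia.
Qed.

(** Resampling all rows except [k] separates the variables: the product over earlier rows sees only
    the second copy, the factor of row [k] only the first. *)
Lemma Expect_prod_rows (g : fspace R 'I_n -> R) (c : R) :
  measurable_fun setT g -> (forall x, 0 <= g x) -> 0 <= c ->
  (forall i, (Expect P (rowX i) g <= c%:E)%E) ->
  (Expect P X (fun x => \prod_(i < m) g (rowof i x))%R <= (c ^+ m)%:E)%E.
Proof.
move=> mg g0 c0 gc.
have mgr i : measurable_fun setT (fun x : F => g (rowof i x)).
  exact: (measurableT_comp mg (measurable_rowof i)).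
have mprod p : measurable_fun setT (fun x : F => \prod_(i < m | (i < p)%N) g (rowof i x)).
  rewrite (_ : (fun x => _) = (fun x : F => \prod_(i < m) (if (i < p)%N then g (rowof i x) else 1))).
    by apply: measurable_prod => i _; case: (i < p)%N; [exact: mgr|exact: measurable_cst].
  by apply/funext => x; rewrite big_mkcond.
have pprod p (x : F) : 0 <= \prod_(i < m | (i < p)%N) g (rowof i x) by apply: prodr_ge0.
suff H p : (p <= m)%N -> (Expect P X (fun x => \prod_(i < m | (i < p)%N) g (rowof i x))%R <= (c ^+ p)%:E)%E.
  have := H m (leqnn m); rewrite (_ : (fun x : F => _) = (fun x : F => \prod_(i < m) g (rowof i x)))//.
  by apply/funext => x; apply: eq_bigl => i; rewrite ltn_ord.
elim: p => [_|p IH pm].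
  rewrite (_ : (fun x : F => _) = (fun=> 1)); last by apply/funext => x; rewrite big_pred0.
  by rewrite /Expect int_cst expr0.
pose k := Ordinal pm; pose J := fun ij : 'I_m * 'I_n => ij.1 == k.
pose A (x : F) := \prod_(i < m | (i < k)%N) g (rowof i x).
have mA : measurable_fun setT (fun w => A (sample X w)).
  exact: (measurableT_comp (mprod p) (measurable_sample iidX)).
have IHA : (Expect P X A <= (c ^+ p)%:E)%E := IH (ltnW pm).
have A0 : (0 <= Expect P X A)%E by apply: int_ge0 => w; exact: pprod.
have Afin : (Expect P X A \is a fin_num)%E.
  by rewrite ge0_fin_numE// (le_lt_trans IHA)// ltry.
pose f (x : F) := (A x * g (rowof k x))%:E.
have mf : measurable_fun setT f.
  by apply/measurable_EFinP; apply: measurable_funM; [exact: mprod|exact: mgr].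
have f0 x : (0 <= f x)%E by rewrite lee_fin mulr_ge0// pprod.
rewrite /Expect (eq_integral (fun w => f (sample X w))); last first.
  by move=> w _; rewrite (prod_below_recr k).
rewrite (integral_mix iidX J mf f0).
rewrite (eq_integral (fun w => (fine (Expect P X A) * g (sample (rowX k) w))%:E)); last first.
  move=> w _; rewrite EFinM fineK// muleC -intZ//; last first.
    by move=> v; exact: pprod.
  apply: eq_integral => v _; rewrite /f mulrC; congr (_ * _)%:E.
    by congr g; apply/funext => j; rewrite /rowof /mix /J /= eqxx.
  apply: eq_bigr => i ik; congr g; apply/funext => j; rewrite /rowof /mix /J /=.
  by case: eqP => // ei; rewrite ei ltnn in ik.
have mgk : measurable_fun setT (fun w => g (sample (rowX k) w)).
  exact: (measurableT_comp mg (measurable_sample (iid_rowX k))).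
rewrite intZ//; last by apply: fine_ge0.
rewrite fineK// exprSr EFinM; apply: lee_pmul => //; last exact: gc.
by apply: int_ge0.
Qed.

Section LowerTail.
Variables (U : 'M[R]_n) (h : R).
Hypothesis Usym : U^T = U.
Hypothesis Udiag : forall j, U j j = h.
Local Notation V := (n%:R ^+ 2 * h ^+ 2 + 4 * \sum_j lowersq U j).
Variable G : set (fspace R 'I_n).
Hypothesis mG : measurable G.
Hypothesis probG : forall (i : 'I_m), (Expect P (rowX i) (\1_(~` G)) <= ((4 * C4)^-1)%:E)%E.

(* Here [sqn U] may replace the second moment [V] of the quadratic form, as it is smaller. *)
Definition low_event : set T :=
  [set w | \sum_(i < m) trunc_sqr U G (rowof i (sample X w)) < m%:R * sqn U / 8].

Lemma measurable_sum_trunc :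
  measurable_fun setT (fun w => \sum_(i < m) trunc_sqr U G (rowof i (sample X w))).
Proof.
apply: measurable_sum => i.
have m1 := measurableT_comp (measurable_rowof i) (measurable_sample iidX).
exact: (measurableT_comp (measurable_trunc_sqr U mG) m1).
Qed.

Lemma measurable_low_event : measurable low_event.
Proof.
have -> : low_event = (fun w => \sum_(i < m) trunc_sqr U G (rowof i (sample X w))) @^-1`
    [set` `]-oo, (m%:R * sqn U / 8)[].
  by apply/seteqP; split => w /=; rewrite in_itv.
rewrite -[X in measurable X]setTI; apply: measurable_sum_trunc => //; exact: measurable_itv.
Qed.

(** Chernoff at the rate [1 / (4 C4 V)]: on the event the exponent is at most [m / (32 C4)], half of
    the [m / (16 C4)] gained from the product over rows. *)
Lemma low_event_le : (P low_event <= (expR (- (m%:R / (32 * C4))))%:E)%E.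
Proof.
have C1 := C4_ge1; have C0 : 0 < C4 by lra.
have sV : sqn U <= V := sqn_lower Usym Udiag.
(* Here the rate is undefined, but [sqn U] vanishes and the strict inequality makes the event
   empty. *)
have [V0|V0] := leP V 0.
  have s0 : sqn U = 0.
    by apply/eqP; rewrite eq_le sqn_ge0 andbT; exact: le_trans V0.
  have -> : low_event = set0.
    rewrite -subset0 => w; rewrite /low_event /= s0 mulr0 mul0r ltNge => /negP; apply.
    by apply: sumr_ge0 => i _; exact: trunc_sqr_ge0.
  by rewrite measure0 lee_fin expR_ge0.
pose t := (4 * C4 * V)^-1.
have t0 : 0 <= t by exact: inv_mul4_ge0.
pose g (x : fspace R 'I_n) := expR (- (t * trunc_sqr U G x)).
have mt := measurable_trunc_sqr U mG.
have mg : measurable_fun setT g by rewrite /g; meas_tac.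
have Hprod : (Expect P X (fun x => \prod_(i < m) g (rowof i x))%R <= (expR (- (16 * C4)^-1) ^+ m)%:E)%E.
  apply: Expect_prod_rows; [exact: mg|by move=> x; exact: expR_ge0|exact: expR_ge0|move=> i].
  exact: (trunc_sqr_mgf (iid_rowX i) Usym Udiag mG (probG i) V0).
have mprod : measurable_fun setT (fun w => \prod_(i < m) g (rowof i (sample X w))).
  apply: measurable_prod => i _.
  have m1 := measurableT_comp (measurable_rowof i) (measurable_sample iidX).
  exact: (measurableT_comp mg m1).
have pprod w : 0 <= \prod_(i < m) g (rowof i (sample X w)).
  by apply: prodr_ge0 => i _; exact: expR_ge0.
have mB := measurable_low_event.
have -> : P low_event = (\int[P]_w (\1_low_event w)%:E)%E by rewrite integral_indic// setIT.
apply: (@le_trans _ _ (\int[P]_w (expR (m%:R / (32 * C4)) * \prod_(i < m) g (rowof i (sample X w)))%:E)%E).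
  apply: int_le; [exact: measurable_indic|by apply: measurable_funM|by []|move=> w].
  rewrite indicE; case: (boolP (w \in low_event)) => [|_]; last by rewrite mulr_ge0 ?expR_ge0.
  rewrite inE /low_event /= => hw.
  rewrite /g -expR_sum -expRD -[X in X <= _]expR0 ler_expR sumrN -mulr_sumr subr_ge0.
  apply: (@le_trans _ _ (t * (m%:R * V / 8))).
    apply: ler_wpM2l => //; apply: (le_trans (ltW hw)).
    by rewrite ler_pM2r// ler_wpM2l.
  have gen (W c M : R) : 0 < W -> 0 < c -> (4 * c * W)^-1 * (M * W / 8) = M / (32 * c).
    by move=> W0 c0; field; rewrite !gt_eqF.
  by rewrite /t gen.
rewrite intZ; [|exact: mprod|exact: pprod|exact: expR_ge0].
apply: (@le_trans _ _ ((expR (m%:R / (32 * C4)))%:E * (expR (- (16 * C4)^-1) ^+ m)%:E)%E).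
  by apply: lee_wpmul2l => //; rewrite lee_fin expR_ge0.
rewrite -EFinM lee_fin -expRM_natl -expRD ler_expR le_eqVlt; apply/orP; left; apply/eqP.
by field; rewrite gt_eqF.
Qed.

End LowerTail.
End Rows.

End Truncation.

(** * From finitely many sums of atoms to all admissible errors *)

Section Deterministic.
Context {R : realType}.

Lemma qformD n (A B : 'M[R]_n) x : qform (A + B) x = qform A x + qform B x.
Proof.
rewrite /qform -big_split; apply: eq_bigr => j _; rewrite -big_split; apply: eq_bigr => k _.
by rewrite mxE /=; ring.
Qed.

Lemma qformZ n c (A : 'M[R]_n) x : qform (c *: A) x = c * qform A x.
Proof.
rewrite /qform mulr_sumr; apply: eq_bigr => j _; rewrite mulr_sumr; apply: eq_bigr => k _.
by rewrite mxE; ring.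
Qed.

Lemma qform_sum n (I : Type) (s : seq I) (A : I -> 'M[R]_n) x :
  qform (\sum_(i <- s) A i) x = \sum_(i <- s) qform (A i) x.
Proof.
elim: s => [|i s IH].
  by rewrite !big_nil /qform big1// => j _; rewrite big1// => k _; rewrite mxE mulr0 mul0r.
by rewrite !big_cons qformD IH.
Qed.

Lemma sqnD_le n (A B : 'M[R]_n) : sqn (A + B) <= 2 * sqn A + 2 * sqn B.
Proof.
rewrite /sqn !mulr_sumr -big_split; apply: ler_sum => i _.
rewrite !mulr_sumr -big_split; apply: ler_sum => j _; rewrite mxE /=.
have := sqr_ge0 (A i j - B i j); lra.
Qed.

Lemma sqnZ n c (A : 'M[R]_n) : sqn (c *: A) = c ^+ 2 * sqn A.
Proof.
rewrite /sqn mulr_sumr; apply: eq_bigr => i _; rewrite mulr_sumr; apply: eq_bigr => j _.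
by rewrite mxE exprMn.
Qed.

(** The sign belongs to the index because the coefficients of [H] may be negative while Maurey's
    weights may not. For fixed [d] there are [(4 n)^d] of these matrices. *)
Definition tuple_matrix n d (s : {ffun 'I_d -> 'I_(2 * n) * bool}) : 'M[R]_n :=
  \sum_(k < d) (-1) ^+ (s k).2 *: atom n (s k).1.

Lemma tuple_matrix_sym n d (s : {ffun 'I_d -> 'I_(2 * n) * bool}) :
  (tuple_matrix s)^T = tuple_matrix s.
Proof.
apply/matrixP => i j; rewrite mxE !summxE; apply: eq_bigr => k _.
by rewrite ![in LHS]mxE ![in RHS]mxE ndistC.
Qed.

Lemma tuple_matrix_diag n d (s : {ffun 'I_d -> 'I_(2 * n) * bool}) :
  forall j, tuple_matrix s j j = (\sum_(k < d) (-1) ^+ (s k).2) / n%:R.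
Proof.
move=> j; rewrite summxE mulr_suml; apply: eq_bigr => k _.
by rewrite [in LHS]mxE atom_diag.
Qed.

(** One application of Maurey's argument approximates [H] in Frobenius norm and in the truncated
    empirical norm at once. The lower bound at the resulting sum [U] then passes to [H], both
    differences being charged to the same error [d B]. *)
Lemma tuple_lower_bound n m d (x : 'I_m -> fspace R 'I_n) (G : set (fspace R 'I_n))
    (H : 'M[R]_n) (K b : R) :
  (0 < n)%N -> (0 < m)%N -> (0 < d)%N -> 0 < b ->
  b = \sum_(l < 2 * n) `|fcoef H l| ->
  H = \sum_(l < 2 * n) fcoef H l *: atom n l ->
  (forall i l, G (x i) -> (l < 2 * n)%N -> `|qform (atom n l) (x i)| <= K) ->
  (forall s : {ffun 'I_d -> 'I_(2 * n) * bool},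
     m%:R * sqn (tuple_matrix s) / 8 <= \sum_i trunc_sqr (tuple_matrix s) G (x i)) ->
  sqn H <= 32 * (\sum_i trunc_sqr H G (x i)) / m%:R + 32 * b ^+ 2 * (2 * (1 + ln n%:R) + K ^+ 2) / d%:R.
Proof.
move=> n0 m0 d0 b0 bE HE GK lowU.
have nR : 0 < n%:R :> R by rewrite ltr0n.
have mR : 0 < m%:R :> R by rewrite ltr0n.
have dR : 0 < d%:R :> R by rewrite ltr0n.
pose c (l : 'I_(2 * n)) := fcoef H l.
pose sg (l : 'I_(2 * n)) : R := (-1) ^+ (c l < 0)%R.
have cE l : c l = sg l * `|c l|.
  rewrite /sg; have [cl|cl] := ltP (c l) 0; first by rewrite ltr0_norm// expr1 mulN1r opprK.
  by rewrite ger0_norm// expr0 mul1r.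
have sg2 l : sg l ^+ 2 = 1 by rewrite /sg sqrr_sign.
pose ind i : R := \1_G (x i).
have ind2 i : ind i ^+ 2 = ind i.
  by rewrite /ind indicE; case: (_ \in _); rewrite ?expr1n ?expr0n.
(* The entries of an atom are concatenated with its truncated measurements; dividing the latter by
   [sqrt m] keeps their squared norm below [K^2]. *)
pose y (l : 'I_(2 * n)) (t : ('I_n * 'I_n) + 'I_m) : R :=
  match t with
  | inl jk => sg l * atom n l jk.1 jk.2
  | inr i => sg l * (ind i * qform (atom n l) (x i)) / Num.sqrt m%:R
  end.
have sqm : (Num.sqrt m%:R) ^+ 2 = m%:R :> R by rewrite sqr_sqrtr// ltW.
have sm0 : 0 < Num.sqrt m%:R :> R by rewrite sqrtr_gt0.
set B := 2 * (1 + ln n%:R) + K ^+ 2.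
have sumT (F : ('I_n * 'I_n) + 'I_m -> R) :
    \sum_t F t = \sum_j \sum_k F (inl (j, k)) + \sum_i F (inr i).
  rewrite big_sumType /=; congr (_ + _).
  by rewrite pair_bigA; apply: eq_bigr => -[].
have yB l : \sum_t y l t ^+ 2 <= B.
  rewrite sumT; apply: lerD.
    apply: le_trans (sqn_atom_le l n0); rewrite le_eqVlt; apply/orP; left; apply/eqP.
    by apply: eq_bigr => j _; apply: eq_bigr => k _; rewrite /y exprMn sg2 mul1r.
  apply: (@le_trans _ _ (\sum_(i < m) K ^+ 2 / m%:R)).
    apply: ler_sum => i _; rewrite /y expr_div_n sqm ler_pM2r ?invr_gt0// exprMn sg2 mul1r exprMn ind2.
    rewrite /ind indicE; case: (boolP (x i \in G)) => [|_] /=; last by rewrite mul0r sqr_ge0.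
    rewrite inE mul1r => Gx; have h := GK i l Gx (ltn_ord l).
    rewrite -real_normK ?num_real// lerXn2r ?nnegrE//; exact: le_trans h.
  by rewrite sumr_const card_ord -[_ *+ m]mulr_natl mulrCA divff ?mulr1// gt_eqF.
pose p l := `|c l| / b.
have p0 l : 0 <= p l by rewrite divr_ge0// ltW.
have p1 : \sum_l p l = 1 by rewrite -mulr_suml -bE divff// gt_eqF.
have [s0 Hs] := maurey d p0 p1 yB.
pose s : {ffun 'I_d -> 'I_(2 * n) * bool} := [ffun k => (s0 k, c (s0 k) < 0)].
(* Sums of [d] atoms approximate [d] times the convex combination [H / b], whence the scale
   [d / b]. *)
pose U := tuple_matrix s; pose la := d%:R / b.
have la0 : 0 < la by rewrite divr_gt0.
have UE : U = \sum_(k < d) sg (s0 k) *: atom n (s0 k).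
  by apply: eq_bigr => k _; rewrite ffunE.
have psg l : d%:R * (p l * sg l) = la * c l by rewrite [c l]cE /p /la; field; rewrite gt_eqF.
pose D := U + (- la) *: H.
have DB : sqn D + (\sum_i trunc_sqr D G (x i)) / m%:R <= d%:R * B.
  apply: le_trans Hs; rewrite le_eqVlt; apply/orP; left; apply/eqP; rewrite sumT; congr (_ + _).
    apply: eq_bigr => j _; apply: eq_bigr => k _; congr (_ ^+ 2).
    rewrite /D UE HE !mxE !summxE; congr (_ + _).
      by apply: eq_bigr => i _; rewrite mxE.
    rewrite mulNr; congr (- _); rewrite !mulr_sumr; apply: eq_bigr => l _.
    have -> : (fcoef H l *: atom n l) j k = c l * atom n l j k by rewrite mxE.
    transitivity (la * c l * atom n l j k); first by ring.
    by rewrite -psg /y /=; ring.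
  rewrite mulr_suml; apply: eq_bigr => i _.
  have -> : \sum_(k < d) y (s0 k) (inr i) - d%:R * (\sum_l p l * y l (inr i)) =
      ind i * qform D (x i) / Num.sqrt m%:R.
    rewrite /D qformD qformZ UE qform_sum {1}HE qform_sum mulrDr mulrDl; congr (_ + _).
      rewrite mulr_sumr mulr_suml; apply: eq_bigr => k _; rewrite /y qformZ; ring.
    rewrite mulNr mulrN mulNr; congr (- _).
    rewrite !mulr_sumr mulr_suml; apply: eq_bigr => l _; rewrite /y qformZ.
    have := psg l; rewrite -/(c l) => psgl.
    transitivity ((d%:R * (p l * sg l)) * (ind i * qform (atom n l) (x i) / Num.sqrt m%:R)); first by ring.
    by rewrite psgl; ring.
  by rewrite expr_div_n sqm exprMn ind2 /trunc_sqr [_ * \1_G _]mulrC.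
have lowUs := lowU s; rewrite -/U in lowUs.
have HU : la ^+ 2 * sqn H <= 2 * sqn U + 2 * sqn D.
  rewrite -sqnZ (_ : la *: H = U + (-1) *: D); last first.
    by rewrite /D scaleN1r opprD addrA subrr sub0r scaleNr opprK.
  by apply: le_trans (sqnD_le _ _) _; rewrite (sqnZ (-1)) sqrrN expr1n mul1r.
have EU : \sum_i trunc_sqr U G (x i) <= 2 * la ^+ 2 * (\sum_i trunc_sqr H G (x i)) +
    2 * \sum_i trunc_sqr D G (x i).
  rewrite !mulr_sumr -big_split; apply: ler_sum => i _; rewrite /trunc_sqr /= -/(ind i).
  have -> : qform U (x i) = la * qform H (x i) + qform D (x i).
    by rewrite /D qformD qformZ; ring.
  have i0 : 0 <= ind i by [].
  have := mulr_ge0 i0 (sqr_ge0 (la * qform H (x i) - qform D (x i))).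
  move: (ind i) (la) (qform H (x i)) (qform D (x i)) => *; lra.
set eH := \sum_i trunc_sqr H G (x i) in EU *; set eD := \sum_i trunc_sqr D G (x i) in EU DB.
set eU := \sum_i trunc_sqr U G (x i) in EU lowUs.
have D0 := sqn_ge0 D.
have k1 : sqn U <= 8 * (2 * la ^+ 2 * eH + 2 * eD) / m%:R.
  rewrite ler_pdivlMr//; lra.
have k2 : la ^+ 2 * sqn H <= la ^+ 2 * (32 * eH / m%:R) + 32 * (d%:R * B).
  have e : 8 * (2 * la ^+ 2 * eH + 2 * eD) / m%:R = la ^+ 2 * (16 * (eH / m%:R)) + 16 * (eD / m%:R) by ring.
  rewrite e in k1; have -> : 32 * eH / m%:R = 32 * (eH / m%:R) by ring.
  move: k1 HU DB D0; move: (eH / m%:R) (eD / m%:R) (la ^+ 2 * sqn H) (sqn U) (sqn D) (d%:R * B) (la ^+ 2) => *; lra.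
have la2 : 0 < la ^+ 2 by rewrite exprn_gt0.
have e : la ^+ 2 * (32 * b ^+ 2 * B / d%:R) = 32 * (d%:R * B) by rewrite /la; field; rewrite !gt_eqF.
by rewrite -(ler_pM2l la2) (le_trans k2)// [leRHS]mulrDr lerD2l e.
Qed.

(** As [b^2 <= 9 r |H|^2], the Maurey error [32 b^2 B / d] is at most [|H|^2 / 2] once
    [d >= 576 r B]. Absorbing it on the left doubles the factor 32. *)
Lemma cone_lower_bound n m d r (x : 'I_m -> fspace R 'I_n) (G : set (fspace R 'I_n))
    (S Shat : 'M[R]_n) (K : R) :
  (0 < n)%N -> (0 < m)%N -> (0 < d)%N ->
  576 * r%:R * (2 * (1 + ln n%:R) + K ^+ 2) <= d%:R ->
  (forall i l, G (x i) -> (l < 2 * n)%N -> `|qform (atom n l) (x i)| <= K) ->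
  (forall s : {ffun 'I_d -> 'I_(2 * n) * bool},
     m%:R * sqn (tuple_matrix s) / 8 <= \sum_i trunc_sqr (tuple_matrix s) G (x i)) ->
  psd S -> psd Shat -> toeplitz S -> toeplitz Shat -> (\rank S <= r)%N -> \tr Shat <= \tr S ->
  m%:R * sqn (Shat - S) <= 64 * \sum_i qform (Shat - S) (x i) ^+ 2.
Proof.
move=> n0 m0 d0 rd GK lowU pS pSh tS tSh rS trS.
have mR : 0 < m%:R :> R by rewrite ltr0n.
have dR : 0 < d%:R :> R by rewrite ltr0n.
have L0 : 0 <= ln n%:R :> R by rewrite ln_ge0// ler1n.
have [H HE] : exists H : 'M[R]_n, H = Shat - S by eexists.
have bl := sum_fcoef_le pS pSh rS trS; rewrite -HE in bl *.
have tH : toeplitz H.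
  by move=> i j k l e; rewrite HE !mxE (tS _ _ _ _ e) (tSh _ _ _ _ e).
have sH : H^T = H by rewrite HE linearB /= pS.1 pSh.1.
have HA := sum_atoms tH sH.
pose b := \sum_(l < 2 * n) `|fcoef H l|; rewrite -/b in bl.
have b0 : 0 <= b by apply: sumr_ge0.
have q0 : 0 <= \sum_i qform H (x i) ^+ 2 by apply: sumr_ge0 => i _; exact: sqr_ge0.
have [bz|bn] := eqVneq b 0.
  have H0 : H = 0.
    rewrite HA big1// => l _.
    have /psumr_eq0P : b = 0 by [].
    by move=> /(_ (fun l _ => normr_ge0 _) l isT) /eqP; rewrite normr_eq0 => /eqP ->; rewrite scale0r.
  have -> : sqn H = 0.
    by rewrite H0 /sqn big1// => i _; rewrite big1// => j _; rewrite mxE expr0n.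
  by rewrite mulr0 mulr_ge0.
have bp : 0 < b by rewrite lt_neqAle eq_sym bn.
have := tuple_lower_bound n0 m0 d0 bp (erefl b) HA GK lowU.
set B := 2 * (1 + ln n%:R) + K ^+ 2 in rd * => main.
have B0 : 0 <= B by rewrite addr_ge0 ?sqr_ge0// mulr_ge0// addr_ge0.
have b2 : b ^+ 2 <= 9 * r%:R * sqn H.
  apply: (@le_trans _ _ ((3 * Num.sqrt r%:R * frob H) ^+ 2)).
    by rewrite lerXn2r ?nnegrE// !mulr_ge0 ?sqrtr_ge0.
  by rewrite !exprMn frob_sqr sqr_sqrtr// le_eqVlt; apply/orP; left; apply/eqP; ring.
have half : 32 * b ^+ 2 * B / d%:R <= sqn H / 2.
  rewrite ler_pdivrMr//.
  apply: (@le_trans _ _ (32 * (9 * r%:R * sqn H) * B)).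
    by rewrite ler_wpM2r// ler_pM2l.
  have := ler_wpM2l (sqn_ge0 H) rd; lra.
have tr_le : \sum_i trunc_sqr H G (x i) <= \sum_i qform H (x i) ^+ 2.
  apply: ler_sum => i _; by rewrite /trunc_sqr ler_piMr ?sqr_ge0.
have k : sqn H / 2 <= 32 * (\sum_i trunc_sqr H G (x i)) / m%:R by lra.
rewrite ler_pdivlMr// in k; lra.
Qed.

End Deterministic.

(** * Use of minimality, choice of constants and the union bound *)

Section Assembly.
Context {R : realType}.

(** Feasibility of [S] gives the trace inequality. Each measurement of the error is the noise minus
    the residual of [Shat], so the squares sum to at most [4 eps^2]; the constant is
    [16 = sqrt (64 * 4)]. *)
Lemma minimizer_bound n m r (a : 'I_m -> 'I_n -> R) (S Shat : 'M[R]_n) (eps : R) (eta : 'cV[R]_m) :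
  0 <= eps -> norm2 eta <= eps -> (0 < m)%N ->
  (psd S -> psd Shat -> toeplitz S -> toeplitz Shat -> (\rank S <= r)%N -> \tr Shat <= \tr S ->
    m%:R * sqn (Shat - S) <= 64 * \sum_i qform (Shat - S) (a i) ^+ 2) ->
  psd S -> toeplitz S -> (\rank S <= r)%N ->
  is_minimizer a (meas a S + eta) eps Shat ->
  frob (Shat - S) <= 16 * eps / Num.sqrt m%:R.
Proof.
move=> e0 eta_e m0 lower_bd pS tS rS [[pSh [nSh tSh]] minSh].
have mR : 0 < m%:R :> R by rewrite ltr0n.
have feasS : feasible a (meas a S + eta) eps S by split=> //; split=> //; rewrite addrC addKr.
have trS := minSh _ feasS.
have := lower_bd pS pSh tS tSh rS trS; have [H HE] : exists H : 'M[R]_n, H = Shat - S by eexists.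
rewrite -HE => bd.
have norm_sq (v : 'cV[R]_m) : norm2 v <= eps -> \sum_i v i ord0 ^+ 2 <= eps ^+ 2.
  move=> h; rewrite -[leLHS]sqr_sqrtr ?sumr_ge0// => [|i _]; last exact: sqr_ge0.
  by rewrite lerXn2r ?nnegrE ?sqrtr_ge0.
have h1 := norm_sq _ eta_e; have h2 := norm_sq _ nSh.
have qle : \sum_i qform H (a i) ^+ 2 <= 4 * eps ^+ 2.
  apply: (@le_trans _ _ (\sum_i (2 * eta i ord0 ^+ 2 +
      2 * (meas a S + eta - meas a Shat) i ord0 ^+ 2))); last first.
    by rewrite big_split /= -!mulr_sumr; lra.
  apply: ler_sum => i _; rewrite !mxE.
  have qE (M : 'M[R]_n) : \sum_(j < n) \sum_(k < n) a i j * M j k * a i k = qform M (a i) by [].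
  rewrite !qE.
  have -> : qform H (a i) = qform Shat (a i) - qform S (a i).
    by rewrite HE qformD -[- S]scaleN1r qformZ mulN1r.
  move: (qform Shat (a i)) (qform S (a i)) (eta i ord0) => u v e.
  have := sqr_ge0 (u - v - 2 * e); lra.
rewrite ler_pdivlMr ?sqrtr_gt0// frobE -sqrtrM ?sqn_ge0//.
rewrite -[leRHS]ger0_norm ?mulr_ge0// -sqrtr_sqr; apply: ler_wsqrtr; lra.
Qed.

(** The number of atoms in a sum is of order [r L^6], so the logarithm of the size of the family is
    of order [r L^7]. Powers of [2 L >= 1] raise everything to [r L^10]. *)
Lemma union_numeric (kap c4 : R) : 0 < kap -> 1 <= c4 ->
  exists2 c0 : R, 0 < c0 & forall n m r : nat, (1 < n)%N -> (0 < r)%N ->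
    c0 * r%:R * ln n%:R ^+ 10 < m%:R ->
    exists2 d : nat, (0 < d)%N &
      576 * r%:R * (2 * (1 + ln n%:R) + (kap * ln n%:R ^+ 3) ^+ 2) <= d%:R /\
      ((2 * n * 2) ^ d)%:R * expR (- (m%:R / (32 * c4))) <= (n%:R ^+ 2)^-1.
Proof.
move=> k0 c41; have c40 : 0 < c4 by lra.
(* [be L^6] bounds the Maurey variance, since [2 (1 + L) <= 6 L <= 192 L^6]; the extra 64 in [ga]
   covers rounding [d] up to an integer. *)
pose be := 192 + kap ^+ 2; pose ga := 576 * be + 64.
have be0 : 0 < be by rewrite /be; have := sqr_ge0 kap; lra.
have ga0 : 0 < ga by rewrite /ga; lra.
have [e10 e10E] : exists e : R, e = 2 ^+ 10 by eexists.
have e10p : 0 < e10 by rewrite e10E exprn_gt0.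
have gap : 0 < 24 * ga + e10 by rewrite addr_gt0// mulr_gt0.
(* The part [24 ga] pays for the union over sums of atoms and [e10] for the target probability
   [1 / n^2]; [32 c4] undoes the Chernoff rate. *)
exists (32 * c4 * (24 * ga + e10)); first by rewrite mulr_gt0// mulr_gt0.
move=> n m r n1 r0 hm.
have L2 := ln_ge_half (R := R) n1.
have nR : 0 < n%:R :> R by rewrite ltr0n ltnW.
have rR : 1 <= r%:R :> R by rewrite ler1n.
have ln2 : ln 2 <= ln n%:R :> R by rewrite ler_ln ?posrE// ler_nat.
set L := ln n%:R in L2 ln2 hm *.
have L0 : 0 < L by lra.
have pw k : 1 <= 2 ^+ k * L ^+ k by rewrite -exprMn exprn_ege1//; lra.
have pL k : 0 < L ^+ k by rewrite exprn_gt0.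
have B1 : 2 * (1 + L) + (kap * L ^+ 3) ^+ 2 <= be * L ^+ 6.
  have e : (kap * L ^+ 3) ^+ 2 = kap ^+ 2 * L ^+ 6 by ring.
  have : 6 * L <= 192 * L ^+ 6.
    have := ler_wpM2l (ltW L0) (pw 5); have -> : L * (2 ^+ 5 * L ^+ 5) = 32 * L ^+ 6 by ring.
    lra.
  by rewrite e /be; lra.
set B := 2 * (1 + L) + _ in B1 *.
have B0 : 0 <= B by rewrite addr_ge0 ?sqr_ge0//; lra.
pose X := 576 * r%:R * B.
have X0 : 0 <= X := mulr_ge0 (mulr_ge0 (ler0n _ _) (ler0n _ _)) B0.
have /andP[d1 d2] : (Num.truncn X)%:R <= X < (Num.truncn X).+1%:R by exact: truncn_itv.
exists (Num.truncn X).+1 => //; split; first exact: ltW.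
set d := (Num.truncn X).+1.
have dle : d%:R <= ga * (r%:R * L ^+ 6).
  have : d%:R <= X + 1 by rewrite /d -natr1; lra.
  have h1 : X <= 576 * be * (r%:R * L ^+ 6).
    have := ler_wpM2l (_ : 0 <= 576 * r%:R) B1; rewrite /X => /(_ _)/wrap[]; first by lra.
    lra.
  have h2 : 1 <= 64 * (r%:R * L ^+ 6).
    have := pw 6; have := ler_wpM2r (ltW (pL 6)) rR; rewrite mul1r.
    have -> : 2 ^+ 6 = 64 :> R by ring.
    lra.
  rewrite /ga; lra.
clearbody d; clear d1 d2 X0 X.
have Nn : (0 < 2 * n * 2)%N by rewrite !muln_gt0 (ltnW n1).
have N0 : 0 < (2 * n * 2)%:R :> R by rewrite ltr0n.
have N1 : 1 <= (2 * n * 2)%:R :> R by rewrite ler1n.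
have ln4n : ln (2 * n * 2)%:R <= 3 * L.
  rewrite !natrM lnM ?posrE ?mulr_gt0// lnM ?posrE//; rewrite -/L; lra.
have -> : ((2 * n * 2) ^ d)%:R = expR (d%:R * ln (2 * n * 2)%:R) :> R.
  by rewrite expRM_natl lnK ?posrE// natrX.
have -> : (n%:R ^+ 2)^-1 = expR (- (2 * L)).
  by rewrite expRN expRM_natl lnK// posrE.
rewrite -expRD ler_expR.
have t1 : d%:R * ln (2 * n * 2)%:R <= 24 * ga * (r%:R * L ^+ 10).
  apply: (@le_trans _ _ (ga * (r%:R * L ^+ 6) * (3 * L))).
    by apply: ler_pM; [exact: ler0n|exact: ln_ge0|exact: dle|exact: ln4n].
  have := ler_wpM2l (_ : 0 <= 3 * (ga * (r%:R * L ^+ 7))) (pw 3).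
  move=> /(_ _)/wrap[]; first by rewrite !mulr_ge0// ltW.
  have -> : 3 * (ga * (r%:R * L ^+ 7)) * (2 ^+ 3 * L ^+ 3) = 24 * ga * (r%:R * L ^+ 10) by ring.
  have -> : ga * (r%:R * L ^+ 6) * (3 * L) = 3 * (ga * (r%:R * L ^+ 7)) by ring.
  lra.
have t2 : 2 * L <= e10 * (r%:R * L ^+ 10).
  have := ler_wpM2l (ltW L0) (pw 9); have -> : L * (2 ^+ 9 * L ^+ 9) = (e10 / 2) * L ^+ 10.
    by rewrite e10E exprS; field.
  have := ler_wpM2l (ltW e10p) (ler_wpM2r (ltW (pL 10)) rR); rewrite mul1r; lra.
have t3 : (24 * ga + e10) * (r%:R * L ^+ 10) <= m%:R / (32 * c4).
  rewrite ler_pdivlMr ?mulr_gt0//.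
  have -> : (24 * ga + e10) * (r%:R * L ^+ 10) * (32 * c4) = 32 * c4 * (24 * ga + e10) * r%:R * L ^+ 10 by ring.
  exact: ltW.
lra.
Qed.

Lemma measure_bigsetU_le (d : measure_display) (T : measurableType d) (P : probability T R)
    (I : Type) (s : seq I) (A : I -> set T) (c : R) :
  (forall i, measurable (A i)) -> (forall i, (P (A i) <= c%:E)%E) ->
  (P (\big[setU/set0]_(i <- s) A i) <= ((size s)%:R * c)%:E)%E.
Proof.
move=> mA Ac; elim: s => [|i s IH]; first by rewrite big_nil measure0 mul0r.
rewrite big_cons; apply: (@le_trans _ _ (P (A i) + P (\big[setU/set0]_(i <- s) A i))%E).
  by apply: measureU2 => //; apply: bigsetU_measurable.
by rewrite /= -[(size s).+1%:R]nat1r mulrDl mul1r EFinD; apply: leeD.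
Qed.

(** For [r = 0] the bound [3 sqrt r |H|] on the coefficients is zero, so the error vanishes for
    every sample. This case is separate because the sample size condition then reads [0 < m] and
    yields no probability estimate. *)
Lemma rank0_frob n (S Shat : 'M[R]_n) :
  psd S -> psd Shat -> toeplitz S -> toeplitz Shat -> (\rank S <= 0)%N -> \tr Shat <= \tr S ->
  frob (Shat - S) = 0.
Proof.
move=> pS pSh tS tSh rS trS.
have bl := sum_fcoef_le pS pSh rS trS.
have [H HE] : exists H : 'M[R]_n, H = Shat - S by eexists.
rewrite -HE in bl *; rewrite sqrtr0 mulr0 mul0r in bl.
have tH : toeplitz H.
  by move=> i j k l e; rewrite HE !mxE (tS _ _ _ _ e) (tSh _ _ _ _ e).
have sH : H^T = H by rewrite HE linearB /= pS.1 pSh.1.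
have -> : H = 0.
  rewrite (sum_atoms tH sH) big1// => l _.
  have : `|fcoef H l| <= 0 by apply: le_trans bl; exact: (term_le_sum l (F := fun l : 'I_(2 * n) => `|fcoef H l|)).
  by rewrite normr_le0 => /eqP ->; rewrite scale0r.
by rewrite frobE /sqn big1 ?sqrtr0// => i _; rewrite big1// => j _; rewrite mxE expr0n.
Qed.

End Assembly.

Unset Implicit Arguments.

Theorem theorem2 (R : realType) (nu : probability R R) :
  subgaussian nu ->
  (\int[nu]_x (x%:E) = 0)%E ->
  (\int[nu]_x ((x ^+ 2)%:E) = 1)%E ->
  (1%:E < \int[nu]_x ((x ^+ 4)%:E))%E ->
  (\int[nu]_x ((x ^+ 4)%:E) <= 3%:E)%E ->
  exists c0 C2 : R, 0 < c0 /\ 0 < C2 /\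
  forall (n m r : nat) (d : measure_display) (T : measurableType d)
    (P : probability T R) (X : 'I_m * 'I_n -> T -> R),
    (forall k, measurable_fun setT (X k)) ->
    (forall k (B : set R), measurable B -> P (X k @^-1` B) = nu B) ->
    mutually_independent P X ->
    c0 * r%:R * ln n%:R ^+ 10 < m%:R ->
    exists E : set T, measurable E /\
      (P E >= (1 - (n%:R ^+ 2)^-1)%:E)%E /\
      forall w, E w ->
        forall (Sigma : 'M[R]_n) (eps2 : R) (eta : 'cV[R]_m),
          psd Sigma -> toeplitz Sigma -> (\rank Sigma <= r)%N ->
          0 <= eps2 -> norm2 eta <= eps2 ->
          let a := fun i j => X (i, j) w in
          let y := meas a Sigma + eta in
          forall Sigmahat : 'M[R]_n, is_minimizer a y eps2 Sigmahat ->
            frob (Sigmahat - Sigma) <= C2 * eps2 / Num.sqrt m%:R.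
Proof.
move=> subg mean0 var1 _ mom4.
have C1 := C4_ge1 nu; have C0 : 0 < C4 nu by exact: lt_le_trans ltr01 C1.
(* This is the tolerance for the complement of [G] under which truncation keeps half of the second
   moment. *)
have de0 : 0 < (4 * C4 nu)^-1 by rewrite invr_gt0 mulr_gt0.
have [kap k0 ctl] := control_exists de0 subg mean0 var1.
have [c0 c00 num] := union_numeric k0 C1.
exists c0, 16; split=> //; split=> // n m r d T P X mX lawX indX hm.
have iidX : iid_family nu P X by split.
have triv : (forall (S Shat : 'M[R]_n), psd S -> psd Shat -> toeplitz S -> toeplitz Shat ->
    (\rank S <= r)%N -> \tr Shat <= \tr S -> frob (Shat - S) = 0) ->
  exists E : set T, measurable E /\ (P E >= (1 - (n%:R ^+ 2)^-1)%:E)%E /\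
      forall w, E w ->
        forall (Sigma : 'M[R]_n) (eps2 : R) (eta : 'cV[R]_m),
          psd Sigma -> toeplitz Sigma -> (\rank Sigma <= r)%N ->
          0 <= eps2 -> norm2 eta <= eps2 ->
          let a := fun i j => X (i, j) w in
          let y := meas a Sigma + eta in
          forall Sigmahat : 'M[R]_n, is_minimizer a y eps2 Sigmahat ->
            frob (Sigmahat - Sigma) <= 16 * eps2 / Num.sqrt m%:R.
  move=> f0; exists setT; split=> //; split.
    by rewrite probability_setT lee_fin lerBlDr lerDl invr_ge0 sqr_ge0.
  move=> w _ S e eta pS tS rS e0 ee a y Sh [[pSh [_ tSh]] minSh].
  rewrite f0//; first by rewrite divr_ge0 ?sqrtr_ge0// mulr_ge0.
  by apply: minSh; split=> //; split=> //; rewrite addrC addKr.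
have [n1|n1] := leqP n 1.
  (* For [n = 0] the inverse of zero is zero, so the event must have probability one, but all
     matrices are empty. For [n = 1] the required probability is zero and the empty event will
     do. *)
  case: n X mX lawX indX hm iidX triv n1 => [|[|//]] X mX lawX indX hm iidX triv _.
    by apply: triv => S Sh *; rewrite /frob big_ord0 sqrtr0.
  by exists set0; split=> //; split=> //; rewrite measure0 expr1n invr1 subrr.
case: (posnP r) => [r0|r0].
  by apply: triv => S Sh; rewrite r0; exact: rank0_frob.
have [dd d0 [dB dP]] := num n m r n1 r0 hm.
have [G [mG GK Gp]] := ctl n n1.
have n0 : (0 < n)%N by exact: ltnW.
have m0 : (0 < m)%N.
  rewrite -(ltr0n R); apply: le_lt_trans hm.
  by rewrite mulr_ge0 ?exprn_ge0 ?ln_ge0 ?ler1n// mulr_ge0// ltW.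
pose I := {ffun 'I_dd -> 'I_(2 * n) * bool}.
pose Ev (s : I) : set T := low_event X (tuple_matrix s) G.
have mEv s : measurable (Ev s) by exact: measurable_low_event iidX _ _ mG.
have pEv s : (P (Ev s) <= (expR (- (m%:R / (32 * C4 nu))))%:E)%E.
  apply: (low_event_le subg mean0 var1 mom4 iidX (tuple_matrix_sym s) (tuple_matrix_diag s) mG).
  by move=> i; apply: Gp; exact: iid_rowX iidX i.
pose Bad := \big[setU/set0]_(s <- enum I) Ev s.
have mBad : measurable Bad by apply: bigsetU_measurable.
exists (~` Bad); split; first exact: measurableC.
split.
  rewrite probability_setC// EFinB leeB//; apply: (le_trans (measure_bigsetU_le _ mEv pEv)).
  rewrite lee_fin; apply: le_trans dP.
  have -> : size (enum I) = ((2 * n * 2) ^ dd)%N.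
    have := card_ffun 'I_dd ('I_(2 * n) * bool)%type.
    rewrite card_prod !card_ord card_bool => <-.
    by rewrite cardT.
  exact: lexx.
move=> w Ew S e eta pS tS rS e0 ee a y Sh minSh.
apply: (minimizer_bound e0 ee m0 _ pS tS rS minSh) => _ pSh _ tSh _ trS.
apply: (cone_lower_bound (x := fun i => rowof i (sample X w)) (G := G) (K := kap * ln n%:R ^+ 3)
  n0 m0 d0 dB _ _ pS pSh tS tSh rS trS).
  by move=> i l Gx l2; exact: GK.
(* A failure of the lower bound for a single [s] would put [w] into [Bad]. *)
move=> s; rewrite leNgt; apply/negP => bad; apply: Ew.
rewrite /Bad (bigD1_seq s) ?mem_enum ?enum_uniq//=; left; exact: bad.
Qed.
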